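(* Let $r_1\ge 2$ be even and $r_2\ge0$ integers. For $n,m,k\in\mathbb{Z}_{\ge0}$ and $\delta\in\{0,1\}$ put $$C_\delta(n,m,k)=\frac{1}{2^{k(k+m)}}\cdot\frac{(2)_{2n+m+\delta}\,(4)_n\,(4)_{n+m}}{(4)_{2n+m+\delta}\,(4)_{n-k}\,(2)_k\,(2)_{k+m}}.$$ Let $V\cong\mathbf{I}^2\boxplus\mathbf{H}^{r_1/2-1}$, and let $W\cong\mathbf{H}^{r_1/2+r_2}$ for types A(i),A(ii) and $W\cong\mathbf{I}^2\boxplus\mathbf{H}^{r_1/2+r_2-1}$ for types B(i)–B(iv). Let $v_{c}$, $w_c$ be the canonical vectors of $V$ and $W$, and let $S^{\mathbb{Q}}\subseteq V\boxplus W$ be a fixed totally isotropic subspace spanned by: A(i): $(v_c,0)$; A(ii): $(v_c,0),(0,w)$; B(i): $(v_c,w_c)$; B(ii): $(v_c,w_c),(0,w)$; B(iii): $(v_c,w_c),(0,w_c)$; B(iv): $(v_c,w_c),(0,w_c),(0,w)$, where $w\in W$ is nonzero with $w\ne w_c$. Choose a maximal totally isotropic subspace $S\subseteq V\boxplus W$ with $S^{\mathbb{Q}}\subseteq S$ uniformly at random, and let $k(S)=\dim_{\mathbb{F}_2}(S\cap V)$. Then $P(k):=\Pr(k(S)=k)$ is given by: (I) Type A(i): $P(k)=C_0(r_1/2-1,r_2+1,k-1)$ for $1\le k\le r_1/2$. (II) Type A(ii): $P(k)=C_0(r_1/2-1,r_2,k-1)$ for $1\le k\le r_1/2$. (III)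 Type B(i): $P(0)=C_1(r_1/2-1,r_2,0)$; $P(k)=C_1(r_1/2-1,r_2,k)+C_1(r_1/2-1,r_2,k-1)/2^{r_1+r_2-1}$ for $0<k<r_1/2$; $P(r_1/2)=C_1(r_1/2-1,r_2,r_1/2-1)/2^{r_1+r_2-1}$. (IV) Type B(ii): if $r_2=0$: $P(1)=C_1(r_1/2-2,1,0)$; $P(k)=C_1(r_1/2-2,1,k-1)+C_1(r_1/2-2,1,k-2)/2^{r_1+r_2-2}$ for $1<k<r_1/2$; $P(r_1/2)=C_1(r_1/2-2,1,r_1/2-2)/2^{r_1+r_2-2}$. If $r_2>0$: $P(0)=C_1(r_1/2-1,r_2-1,0)$; $P(k)=C_1(r_1/2-1,r_2-1,k)+C_1(r_1/2-1,r_2-1,k-1)/2^{r_1+r_2-2}$ for $0<k<r_1/2$; $P(r_1/2)=C_1(r_1/2-1,r_2-1,r_1/2-1)/2^{r_1+r_2-2}$. (V) Type B(iii): $P(k)=C_0(r_1/2-1,r_2,k-1)$ for $1\le k\le r_1/2$. (VI) Type B(iv): if $r_2=0$, $P(k)=C_0(r_1/2-2,1,k-2)$ for $2\le k\le r_1/2$; otherwise $P(k)=C_0(r_1/2-1,r_2-1,k-1)$ for $1\le k\le r_1/2$.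
   Context: All spaces are finite-dimensional $\mathbb{F}_2$-vector spaces with nondegenerate symmetric bilinear forms. $\mathbf{I}=\mathbb{F}_2$ with form $b(x,y)=xy$; $\mathbf{H}=\mathbb{F}_2^2$ with form given by the matrix $\begin{pmatrix}0&1\\1&0\end{pmatrix}$; $\boxplus$ denotes orthogonal direct sum and powers denote iterated orthogonal sums; $V\cap$ in $S\cap V$ means $S\cap(V\boxplus 0)$. The canonical vector of $(U,b)$ is the unique $c\in U$ with $b(c,x)=b(x,x)$ for all $x\in U$ (it is $0$ for $\mathbf{H}^t$ and a nonzero isotropic vector for $\mathbf{I}^2\boxplus\mathbf{H}^t$). A subspace $S$ is totally isotropic if $b(x,y)=0$ for all $x,y\in S$, and maximal totally isotropic if maximal among such. The $q$-Pochhammer symbol is $(q)_m=\prod_{i=1}^m(1-q^{-i})$, $(q)_0=1$. *)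

(* Defs.v *)
From HB Require Import structures.
From mathcomp Require Import all_boot all_order all_algebra.
From mathcomp Require Import finfield.

Set Implicit Arguments.
Unset Strict Implicit.
Unset Printing Implicit Defensive.

Import GRing.Theory.
Local Open Scope ring_scope.

Record bspace := BSpace {
  bsort :> vectType 'F_2;
  bform : {symmetric bsort};
  bform_nondegenerate : nondegenerate bform }.

Arguments bform {b}.

Section MakeForm.
Variables (vT : vectType 'F_2) (b : vT -> vT -> 'F_2).
Hypothesis b_lin : forall z a x y, b (a *: x + y) z = a * b x z + b y z.
Hypothesis b_sym : forall x y, b x y = b y x.
Hypothesis b_ndg : forall x, (forall y, b x y = 0) -> x = 0.

Let bl z : linear_for *%R (b^~ z). Proof. exact: b_lin. Qed.
Let br z : linear_for *%R (b z).
Proof. by move=> a x y; rewrite ![b z _]b_sym b_lin. Qed.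
Let b_herm x y : b x y = (-1) ^+ false * idfun (b y x).
Proof. by rewrite expr0 mul1r b_sym. Qed.

Definition mk_form : {symmetric vT} :=
  HB.pack b
    (isBilinear.Build 'F_2 vT vT 'F_2 *%R (idfun \; *%R) b
      (fun z => zmod_morphism_linear (bl z))
      (fun z => zmod_morphism_linear (br z))
      (fun z => scalable_linear (bl z))
      (fun z => scalable_linear (br z)))
    (isHermitianSesquilinear.Build 'F_2 vT false idfun b b_herm).

Fact mk_form_nondegenerate : nondegenerate mk_form.
Proof.
rewrite /nondegenerate -subv0; apply/subvP => x /mem_orthovP xb.
by rewrite memv0; apply/eqP/b_ndg => y; exact/xb/memvf.
Qed.

Definition mk_bspace := BSpace mk_form_nondegenerate.
End MakeForm.

Section SpaceI.
Let b (x y : ('F_2)^o) : 'F_2 := (x : 'F_2) * y.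
Fact bI_lin z a x y : b (a *: x + y) z = a * b x z + b y z.
Proof. by rewrite /b mulrDl -mulrA. Qed.
Fact bI_sym x y : b x y = b y x. Proof. exact: mulrC. Qed.
Fact bI_ndg x : (forall y, b x y = 0) -> x = 0.
Proof. by move=> /(_ 1); rewrite /b mulr1. Qed.
Definition spI : bspace := mk_bspace bI_lin bI_sym bI_ndg.
End SpaceI.

Section SpaceH.
Definition gramH : 'M['F_2]_2 := \matrix_(i, j) (i != j)%:R.
Let b (x y : 'rV['F_2]_2) : 'F_2 := sesquilinear.form idfun gramH x y.
Fact bH_lin z a x y : b (a *: x + y) z = a * b x z + b y z.
Proof. by rewrite /b formDl formZl. Qed.
Fact bH_sym x y : b x y = b y x.
Proof.
rewrite /b (@formC _ _ false) ?expr0 ?mul1r //.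
by apply/sesquiP; rewrite expr0 scale1r; apply/matrixP => i j; rewrite !mxE eq_sym.
Qed.
Fact bH_ndg x : (forall y, b x y = 0) -> x = 0.
Proof.
move=> x0; apply/rowP => j; rewrite mxE.
have := x0 'e_(rev_ord j).
rewrite /b /sesquilinear.form trmx_delta map_delta_mx -colE !mxE.
rewrite (bigD1 j) //= big1 => [|i]; rewrite !mxE.
  by rewrite addr0; case: j => -[|[]] // ltj; rewrite mulr1.
by case: j i => -[|[]] // ltj [[|[]] // lti]; rewrite ?mulr0 // => /eqP[]; apply/val_inj.
Qed.
Definition spH : bspace := mk_bspace bH_lin bH_sym bH_ndg.
End SpaceH.

Section Zero.
Let b (x y : 'rV['F_2]_0) : 'F_2 := 0.
Fact b0_lin z a x y : b (a *: x + y) z = a * b x z + b y z.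
Proof. by rewrite /b mulr0 addr0. Qed.
Fact b0_ndg x : (forall y, b x y = 0) -> x = 0.
Proof. by move=> _; apply: thinmx0. Qed.
Definition spO : bspace := mk_bspace b0_lin (fun _ _ => erefl) b0_ndg.
End Zero.

Section OrthogonalSum.
Variables U V : bspace.
Let b (x y : U * V) : 'F_2 := bform x.1 y.1 + bform x.2 y.2.
Fact bsum_lin z a x y : b (a *: x + y) z = a * b x z + b y z.
Proof.
by rewrite /b /= !linearDl !linearZl_LR /= mulrDr addrACA.
Qed.
Fact bsum_sym x y : b x y = b y x.
Proof. by rewrite /b; congr (_ + _); rewrite [LHS]hermC expr0 mul1r. Qed.
Fact bsum_ndg x : (forall y, b x y = 0) -> x = 0.
Proof.
case: x => u v uv0; congr (_, _); apply/eqP; rewrite -memv0.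
  rewrite -(eqP (bform_nondegenerate U)); apply/mem_orthovP => y _.
  by have := uv0 (y, 0); rewrite /b /= linear0r addr0.
rewrite -(eqP (bform_nondegenerate V)); apply/mem_orthovP => y _.
by have := uv0 (0, y); rewrite /b /= linear0r add0r.
Qed.
Definition osum : bspace := mk_bspace bsum_lin bsum_sym bsum_ndg.
End OrthogonalSum.

Lemma spIE (x y : spI) : bform x y = (x : 'F_2) * (y : 'F_2).
Proof. by []. Qed.

Lemma spHE (x y : spH) : bform x y = (x *m gramH *m y^T) 0 0.
Proof. by rewrite -[y^T](map_mx_id (fun _ => erefl)). Qed.

Lemma osumE (U V : bspace) (x y : osum U V) :
  bform x y = bform x.1 y.1 + bform x.2 y.2.
Proof. by []. Qed.

Notation "U ⊞ V" := (osum U V) (at level 50, left associativity).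

Definition opair (U V : bspace) (u : U) (v : V) : U ⊞ V := (u, v).
Arguments opair {U V} (u v)%_R.

(* spO is the zero space, so opow U n is U ⊞ (... ⊞ (U ⊞ spO)). *)
Definition opow (U : bspace) (n : nat) : bspace := iter n (osum U) spO.

Definition isometric (U V : bspace) : Prop :=
  exists2 f : 'Hom(U, V), bijective f & isometry (@bform V) (@bform U) f.

Section Canonical.
Variable U : bspace.

(* [finvect_type U] is U with its finite type structure. *)
Definition is_canonical (c : U) : bool :=
  [forall x : finvect_type U, bform c x == bform (x : U) x].

Lemma is_canonicalP (c : U) :
  reflect (forall x : U, bform c x = bform x x) (is_canonical c).
Proof. apply: (iffP forallP) => cP x; first exact/eqP/cP.
exact/eqP/cP. Qed.

Lemma is_canonical_uniq (c d : U) :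
  is_canonical c -> is_canonical d -> c = d.
Proof.
move=> /is_canonicalP cP /is_canonicalP dP; apply/eqP; rewrite -subr_eq0 -memv0.
rewrite -(eqP (bform_nondegenerate U)); apply/mem_orthovP => y _.
by rewrite linearBl /= cP dP subrr.
Qed.

Lemma is_canonical_ex : exists c : U, is_canonical c.
Proof.
pose e := vbasis {:U}; pose n := \dim {:U}.
pose g (u : U) : U := \sum_(j < n) bform u e`_j *: e`_j.
have g_lin : linear g.
  move=> a u v; rewrite /g scaler_sumr -big_split /=; apply: eq_bigr => j _.
  by rewrite linearDl linearZl_LR /= scalerDl scalerA.
pose gL : {linear U -> U} := HB.pack g (GRing.isLinear.Build _ _ _ _ g g_lin).
have e_free : free e := basis_free (vbasisP {:U}).
have gE (k : 'I_n) (F : 'I_n -> 'F_2) : coord e k (\sum_j F j *: e`_j) = F k.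
  exact: coord_sum_free.
have coordU (x : U) : x = \sum_(j < n) coord e j x *: e`_j.
  exact/coord_vbasis/memvf.
have ker0 : lker (linfun gL) == 0%VS.
  rewrite -subv0; apply/subvP => u; rewrite memv_ker lfunE /= => /eqP gu0.
  rewrite memv0 -memv0 -(eqP (bform_nondegenerate U)).
  apply/mem_orthovP => y _; rewrite (coordU y) linear_sumr big1 // => j _.
  by rewrite linearZr_LR /= -(gE j (fun j => bform u e`_j)) -/(g u) gu0 linear0 mulr0.
pose t : U := \sum_(j < n) bform e`_j e`_j *: e`_j.
have: t \in limg (linfun gL) by rewrite lker0_limgf // memvf.
case/memv_imgP => c _; rewrite lfunE /= => cP; rewrite /t in cP.
exists c; apply/is_canonicalP => x.
have cE (j : 'I_n) : bform c e`_j = bform e`_j e`_j.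
  by rewrite -(gE j (fun j => bform c e`_j)) -/(g c) -cP gE.
rewrite (coordU x); elim/big_ind: _ => [|u v cu cv|j _].
- by rewrite !linear0r.
- rewrite hnormD /= expr0 mul1r linearDr /= cu cv -mulr2n.
  by rewrite -mulr_natr (pchar_Fp_0 (isT : prime 2)) mulr0 addr0.
rewrite !linearZr_LR /= linearZl_LR /= cE mulrA; congr (_ * _).
by case: (coord e j x) => -[|[|[]]] // i; apply/val_inj.
Qed.

Definition canonical : U := xchoose is_canonical_ex.

Lemma canonicalP (x : U) : bform canonical x = bform x x.
Proof. exact: (is_canonicalP _ (xchooseP is_canonical_ex)). Qed.
End Canonical.
Arguments canonical : clear implicits.

HB.instance Definition _ (F : finFieldType) (vT : vectType F) :=
  isCountable.Build {vspace vT}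
    (pcan_pickleK (can_pcan (@VectorInternalTheory.vs2mxK F vT))).
HB.instance Definition _ (F : finFieldType) (vT : vectType F) :=
  isFinite.Build {vspace vT}
    (pcan_enumP (can_pcan (@VectorInternalTheory.vs2mxK F vT))).

Section Isotropic.
Variable U : bspace.
Implicit Types S T : {vspace U}.

Definition totally_isotropic S : bool := (S <= orthov (@bform U) S)%VS.

Lemma totally_isotropicP S :
  reflect {in S &, forall x y, bform x y = 0} (totally_isotropic S).
Proof. exact: orthovP. Qed.

Definition max_totally_isotropic S : bool :=
  totally_isotropic S &&
  [forall T, (totally_isotropic T && (S <= T)%VS) ==> (T == S)].

Lemma max_totally_isotropicP S :
  reflect (totally_isotropic S /\
           forall T, totally_isotropic T -> (S <= T)%VS -> T = S)
          (max_totally_isotropic S).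
Proof.
apply: (iffP andP) => -[S0 Smax]; split=> //.
  by move=> T T0 ST; apply/eqP; apply: (implyP (forallP Smax T)); rewrite T0.
by apply/forallP => T; apply/implyP => /andP[T0 ST]; apply/eqP/Smax.
Qed.
End Isotropic.

Section Inl.
Variables U V : bspace.
Definition inl_vec (u : U) : U ⊞ V := opair u 0.
Fact inl_vec_linear : linear inl_vec.
Proof. by move=> a u v; congr (_, _) => /=; rewrite [a *: 0]scaler0 addr0. Qed.
HB.instance Definition _ := GRing.isLinear.Build 'F_2 U (U ⊞ V) _ inl_vec inl_vec_linear.
Definition summandl : {vspace U ⊞ V} := limg (linfun inl_vec).
End Inl.

Definition unif_prob (T : finType) (A : {set T}) (P : pred T) : rat :=
  #|[set x in A | P x]|%:R / #|A|%:R.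

Definition prob_dim (V W : bspace) (SQ : {vspace V ⊞ W}) (k : nat) : rat :=
  unif_prob [set S | max_totally_isotropic S & (SQ <= S)%VS]
            (fun S => \dim (S :&: summandl V W) == k).

(* (q)_m is taken in the variable 1/q. *)
Definition qpoch (q : rat) (m : nat) : rat := \prod_(1 <= i < m.+1) (1 - q ^- i).

(* n - k is truncated; only meaningful for k <= n and delta <= 1. *)
Definition C (delta n m k : nat) : rat :=
  1 / 2 ^+ (k * (k + m)) *
  ((qpoch 2 (2 * n + m + delta) * qpoch 4 n * qpoch 4 (n + m)) /
   (qpoch 4 (2 * n + m + delta) * qpoch 4 (n - k) * qpoch 2 k * qpoch 2 (k + m))).

(* Main.v *)
(* The canonical vector (v_c, w_c) of V ⊞ W lies in Q = S^Q, so the subspaces S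
   to be counted are those with S = S^⊥ and Q <= S: they are the Lagrangians of
   the symplectic space Q^⊥/Q. Up to a shift, dim (S ∩ V) is the dimension of
   S ∩ A for A = (V ∩ Q^⊥) + Q, whose radical modulo Q has dimension d <= 1.
   Let X(N, n, d, k) be the number of Lagrangians L in dimension 2N that meet a
   given A of dimension 2n + d, with radical of dimension d, in dimension k.
   Counting the pairs (L, x) with x a nonzero vector of L ∩ A gives
     (2^k - 1) X(N,n,d,k) =
       (2^d - 1) X(N-1,n,d-1,k-1) + (2^(2n+d) - 2^d) X(N-1,n-1,d,k-1),
   and comparing A with a hyperplane of A gives, for k = 0,
     X(N,n,0,0) = X(N,n-1,1,0) - 2^(2n-1) X(N-1,n-1,0,0),
     X(N,n,1,0) = X(N,n,0,0) - X(N-1,n,0,0) - (2^(2n) - 1) X(N-1,n-1,1,0).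
   The closed formulas solve these recursions. Instead of passing to the
   quotient by x, we enlarge Q to Q + <x>. *)
From HB Require Import structures.
Require Import Defs.
From mathcomp Require Import all_boot all_order all_algebra finfield.
From mathcomp Require Import zify ring lra.

Set Implicit Arguments.
Unset Strict Implicit.
Unset Printing Implicit Defensive.

Import Order.TTheory GRing.Theory Num.Theory.
Local Open Scope ring_scope.

(** * Orthogonals in a nondegenerate space over 'F_2 *)

Local Notation "S ^⊥" := (orthov (@bform _) S)
  (at level 2, format "S ^⊥") : vspace_scope.

Lemma card_vect (vT : vectType 'F_2) (A : {vspace vT}) :
  #|[set x : finvect_type vT | x \in A]| = (2 ^ \dim A)%N.
Proof.
case: vT A => T c A.
have := @card_vspace 'F_2 (finvect_type (Vector.Pack c)) c A.
by rewrite card_Fp // => <-; apply: eq_card => x; rewrite inE.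
Qed.

Section Orthogonal.
Variable U : bspace.
Implicit Types (x y : U) (Q A B L S T : {vspace U}).

Lemma bformC x y : bform x y = bform y x.
Proof. by rewrite hermC expr0 mul1r. Qed.

Lemma addvvF2 x : x + x = 0.
Proof. by rewrite -mulr2n -scaler_nat pchar_Fp_0 // scale0r. Qed.

Lemma memv_lineF2 x y : (y \in <[x]>%VS) = (y == 0) || (y == x).
Proof.
apply/idP/orP => [/vlineP[a ->]|[/eqP->|/eqP->]].
- case: a => -[|[|[]]] // lta; [left|right].
    by rewrite (_ : Ordinal lta = 0) ?scale0r //; apply/val_inj.
  by rewrite (_ : Ordinal lta = 1) ?scale1r //; apply/val_inj.
- exact: mem0v.
exact: memv_line.
Qed.

Lemma orthovS S T : (S <= T -> T^⊥ <= S^⊥)%VS.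
Proof.
move=> ST; apply/subvP => x /mem_orthovP xT; apply/mem_orthovP => y yS.
exact/xT/(subvP ST).
Qed.

Lemma orthov_add S T : ((S + T)^⊥ = S^⊥ :&: T^⊥)%VS.
Proof.
apply/eqP; rewrite eqEsubv subv_cap !orthovS ?addvSl ?addvSr //=.
by rewrite orthov_sym orthoDv orthov_sym capvSl orthov_sym capvSr.
Qed.

Lemma sub_orthovK S : (S <= S^⊥^⊥)%VS.
Proof. by rewrite orthov_sym. Qed.

(** Each vector of a basis of [T] cuts the dimension by at most one. *)
Lemma leq_dim_cap_orthov S T : (\dim S <= \dim (S :&: T^⊥)%VS + \dim T)%N.
Proof.
have: (\dim S <= \dim (S :&: <<vbasis T>>^⊥)%VS + size (vbasis T))%N.
  elim: (tval (vbasis T)) S => [|x X IH] S.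
    by rewrite span_nil orthov0 capvf addn0.
  rewrite span_cons orthov_add capvA /= addnS.
  have := IH (S :&: <[x]>^⊥)%VS.
  have : ((\dim S).-1 <= \dim (S :&: <[x]>^⊥))%N by exact: leq_dim_orthov1.
  by move: (size X) => m; lia.
by rewrite (span_basis (vbasisP T)) size_tuple.
Qed.

(** The bound [leq_dim_cap_orthov] applies to [S] and to its complement [S^C]; as [S^⊥] and [S^C^⊥]
    meet in [0], both bounds are attained. *)
Lemma dim_orthov S : (\dim S^⊥%VS + \dim S)%N = \dim {:U}.
Proof.
have := leq_dim_cap_orthov {:U} S; have := leq_dim_cap_orthov {:U} S^C.
rewrite !capfv; have := dimv_sum_cap S^⊥ S^C^⊥.
rewrite -orthov_add addv_complf (eqP (bform_nondegenerate U)) dimv0.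
have := dimvS (subvf (S^⊥ + S^C^⊥)); rewrite dimv_compl.
have := dimvS (subvf S); lia.
Qed.

Lemma orthovK S : (S^⊥^⊥ = S)%VS.
Proof.
apply/eqP; rewrite eq_sym eqEdim sub_orthovK /=.
have := dim_orthov S; have := dim_orthov S^⊥; lia.
Qed.

Lemma orthov_cap S T : ((S :&: T)^⊥ = S^⊥ + T^⊥)%VS.
Proof. by rewrite -[RHS]orthovK orthov_add !orthovK. Qed.

(** For a totally isotropic [Q] this makes [Q^⊥/Q] symplectic. *)
Lemma canonical_isotropic Q x :
  canonical U \in Q -> x \in (Q^⊥)%VS -> bform x x = 0 :> 'F_2.
Proof. by move=> cQ /mem_orthovP /(_ _ cQ); rewrite bformC canonicalP. Qed.

Lemma isotropic_add_line Q x :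
  (Q <= Q^⊥ -> x \in Q^⊥ -> bform x x = 0%R -> Q + <[x]> <= (Q + <[x]>)^⊥)%VS.
Proof.
rewrite memvE => QQ xQ xx.
by rewrite orthoDv !orthovD QQ [(Q <= _)%VS]orthov_sym xQ orthov11 xx eqxx.
Qed.

(* When the canonical vector lies in L, every vector of L^⊥ is isotropic, so L
   extends as long as L is smaller than L^⊥. *)
Lemma max_isotropicE L : canonical U \in L ->
  max_totally_isotropic L = (L == L^⊥)%VS.
Proof.
move=> cL; apply/max_totally_isotropicP/eqP => [[LL Lmax]|LL]; last first.
  split=> [|T TT LT]; first by rewrite /totally_isotropic -LL.
  by apply/eqP; rewrite eqEsubv LT andbT LL (subv_trans TT) ?orthovS.
apply/eqP; rewrite eqEsubv [(L <= _)%VS]LL; apply/subvP => x xL.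
rewrite -(Lmax (L + <[x]>)%VS) ?addvSl //; first exact: (addvSr L <[x]>).
by apply: isotropic_add_line => //; apply: canonical_isotropic xL.
Qed.

Lemma card_vectD A B : (B <= A)%VS ->
  #|[set x : finvect_type U | (x \in A) && (x \notin B)]| =
    (2 ^ \dim A - 2 ^ \dim B)%N.
Proof.
move=> /subvP BA; rewrite -!card_vect -cardsDS.
  by apply: eq_card => x; rewrite !inE andbC.
by apply/subsetP => x; rewrite !inE => /BA.
Qed.

End Orthogonal.

(** * Double counting of Lagrangians *)

Section Lagrangians.
Variable U : bspace.
Implicit Types (x y : U) (Q A B L S T : {vspace U}) (k : nat).

(** [k] is the dimension of [L ∩ A] itself, not of its image modulo [Q]; for [Q <= A] it is
    therefore at least [\dim Q]. *)
Definition is_lag Q A k L : bool :=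
  [&& L == (L^⊥)%VS, (Q <= L)%VS & \dim (L :&: A) == k].

Definition lag Q A k : {set {vspace U}} := [set L | is_lag Q A k L].

Lemma lagE Q A k L : (L \in lag Q A k) = is_lag Q A k L.
Proof. by rewrite inE. Qed.

(** By [lag_mem], the number of members of [lag Q A k] through [x]. *)
Definition card_lag_line Q A k x : nat :=
  #|lag (Q + <[x]>) (A :&: <[x]>^⊥) k|.

Lemma dim_add_line S x : x \notin S -> \dim (S + <[x]>) = (\dim S).+1.
Proof.
move=> xS; rewrite dimv_disjoint_sum.
  rewrite dim_vline (_ : x != 0) ?addn1 //.
  by apply: contraNneq xS => ->; apply: mem0v.
apply/eqP; rewrite -subv0; apply/subvP => y; rewrite memv_cap memv_lineF2.
case/andP => yS /orP[/eqP->|/eqP yx]; first exact: mem0v.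
by rewrite -yx yS in xS.
Qed.

Lemma double_count (Z : {set {vspace U}}) (X : {set finvect_type U}) m :
    (forall L, L \in Z -> #|[set x : finvect_type U in X | x \in L]| = m) ->
  (#|Z| * m = \sum_(x in X) #|[set L in Z | x \in L]|)%N.
Proof.
move=> Zm; rewrite -sum_nat_const -(eq_bigr _ Zm).
under eq_bigr do rewrite -sum1dep_card big_mkcondr.
rewrite exchange_big /=; apply: eq_bigr => x _.
by rewrite -sum1dep_card [RHS]big_mkcondr.
Qed.

(** If [x] is in [L = L^⊥], then [L] lies in [<x>^⊥], so cutting [A] down to [<x>^⊥] does not change
    [L ∩ A]. *)
Lemma lag_mem Q A k x :
  [set L in lag Q A k | x \in L] = lag (Q + <[x]>) (A :&: <[x]>^⊥) k.
Proof.
apply/setP => L; rewrite !(inE, lagE) /is_lag subv_add -memvE.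
case: eqP => //= LL; case: (Q <= L)%VS => //=.
case: (boolP (x \in L)) => xL; rewrite ?andbF ?andbT //=.
congr (\dim _ == k); rewrite capvA [RHS]capvC; apply/esym/capv_idPr.
rewrite (subv_trans (capvSl _ _)) // {1}LL; apply: orthovS; exact: xL.
Qed.

(** Counts pairs [(L, x)] with [x] in [L ∩ A] outside [Q]; such [x] replace the nonzero vectors of
    the quotient by [Q]. *)
Lemma lag_count Q A k : (Q <= A)%VS ->
  (#|lag Q A k| * (2 ^ k - 2 ^ \dim Q) =
   \sum_(x : finvect_type U | (x \in A) && (x \notin Q))
      card_lag_line Q A k x)%N.
Proof.
move=> QA.
pose X := [set x : finvect_type U | (x \in A) && (x \notin Q)].
rewrite (@double_count _ X) => [|L].
  by apply: eq_big => [x|x _]; rewrite ?inE // /card_lag_line -lag_mem.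
rewrite lagE => /and3P[_ QL /eqP <-]; rewrite -card_vectD ?subv_cap ?QL //.
by apply: eq_card => x; rewrite !inE (@memv_cap _ U x L A) andbC andbA.
Qed.

(** An [L] meeting [B] only in [Q] meets [A] in at most one more dimension. If it gains one, it
    contains exactly [2 ^ \dim Q] vectors of [A] outside [B], so these [L] are counted by pairs
    [(L, x)]. *)
Lemma lag_hyperplane Q A B : (Q <= B)%VS -> (B <= A)%VS ->
    \dim A = (\dim B).+1 ->
  (#|lag Q B (\dim Q)| * 2 ^ \dim Q = #|lag Q A (\dim Q)| * 2 ^ \dim Q +
   \sum_(x : finvect_type U | (x \in A) && (x \notin B))
      card_lag_line Q A (\dim Q).+1 x)%N.
Proof.
move=> QB BA dA; set q := \dim Q.
pose Z := lag Q B q :&: lag Q A q.+1.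
have capB L : (\dim (L :&: B) <= \dim (L :&: A) <= (\dim (L :&: B)).+1)%N.
  rewrite dimvS ?capvS //=.
  have := dimv_sum_cap (L :&: A) B; rewrite -capvA (capv_idPr BA).
  have : (\dim (L :&: A + B) <= \dim A)%N by rewrite dimvS // subv_add capvSr.
  lia.
have leq_q L : (Q <= L)%VS -> (q <= \dim (L :&: B))%N.
  by move=> QL; rewrite dimvS // subv_cap QL.
have -> : lag Q B q = lag Q A q :|: Z.
  apply/setP => L; rewrite !(inE, lagE) /is_lag; case: (L == _) => //=.
  case: (boolP (Q <= L)%VS) => //= QL; have := leq_q L QL; have := capB L.
  by lia.
have dAZ : [disjoint lag Q A q & Z].
  rewrite -setI_eq0; apply/eqP/setP => L.
  rewrite in_setI in_setI in_set0 !lagE /is_lag.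
  case: (L == _) => //=; case: (Q <= L)%VS => //=; lia.
rewrite cardsU (disjoint_setI0 dAZ) cards0 subn0 mulnDl; congr addn.
pose X := [set x : finvect_type U | (x \in A) && (x \notin B)].
rewrite (@double_count _ X) => [|L].
  apply: eq_big => [x|x]; rewrite !inE // => /andP[xA xB].
  rewrite /card_lag_line -lag_mem; apply: eq_card => L.
  rewrite !(inE, lagE) /is_lag.
  case: (L == _) => //=; case: (boolP (Q <= L)%VS) => //= QL.
  rewrite -andbA; case: (boolP (x \in L)) => xL; rewrite ?andbF // !andbT.
  case: (_ =P q.+1) => [dLA|_]; rewrite ?andbF // andbT.
  (* Otherwise [L ∩ B] has the dimension of [L ∩ A], hence equals it, although [x] lies in [L ∩ A]
     and not in [B]. *)
  rewrite eqn_leq leq_q // andbT -ltnS -dLA ltn_neqAle dimvS ?capvS // andbT.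
  apply: contra xB => /eqP dLAB; have : (L :&: A <= L :&: B)%VS.
    by rewrite -(geq_leqif (dimv_leqif_sup _)) ?dLAB ?capvS.
  by move/subvP/(_ x); rewrite !(@memv_cap _ U x) xL xA => /(_ isT).
rewrite !(inE, lagE) => /andP[/and3P[_ _ /eqP dB] /and3P[_ _ /eqP dLA]].
rewrite -[RHS](addnK (2 ^ q)) addnn -mul2n -expnS -{1}dLA -{1}dB.
rewrite -card_vectD ?capvS //.
apply: eq_card => x; rewrite !inE (@memv_cap _ U x L A) (@memv_cap _ U x L B).
by case: (x \in L); rewrite ?andbT ?andbF.
Qed.

End Lagrangians.

(** * The closed form and its recursions *)

Lemma qpoch0 q : qpoch q 0 = 1.
Proof. by rewrite /qpoch big_geq. Qed.

Lemma qpochS q m : qpoch q m.+1 = qpoch q m * (1 - q ^- m.+1).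
Proof. by rewrite /qpoch big_nat_recr. Qed.

Lemma qpoch_neq0 q m : 1 < q -> qpoch q m != 0.
Proof.
move=> q1; elim: m => [|m IH]; first by rewrite qpoch0 oner_eq0.
rewrite qpochS mulf_neq0 // subr_eq0 eq_sym invr_eq1.
by rewrite gt_eqF // exprn_egt1.
Qed.

Lemma qpoch2_neq0 m : qpoch 2 m != 0. Proof. exact: qpoch_neq0. Qed.
Lemma qpoch4_neq0 m : qpoch 4 m != 0. Proof. exact: qpoch_neq0. Qed.

Lemma expr2_neq0 m : 2 ^+ m != 0 :> rat.
Proof. by rewrite expf_neq0. Qed.

Lemma expr2B1_neq0 m : 2 ^+ m.+1 - 1 != 0 :> rat.
Proof. by rewrite subr_eq0 gt_eqF // exprn_egt1. Qed.

Lemma expr4E m : 4 ^+ m = 2 ^+ m * 2 ^+ m :> rat.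
Proof. by rewrite -exprMn -natrM. Qed.

Lemma expr2_bin m : 2 ^+ 'C(m.+2, 2) = 2 ^+ m.+1 * 2 ^+ 'C(m.+1, 2) :> rat.
Proof. by rewrite binS bin1 addnC exprD. Qed.

(* The number of maximal totally isotropic subspaces of a symplectic space of
   dimension 2N, times [C d n (N - 2n - d) k]; it also makes sense when
   N < 2n + d, provided that k is large enough. *)
Definition num_lag N n d k : rat :=
  if (k <= n)%N && (2 * n + d <= N + k)%N then
    2 ^+ 'C(N.+1, 2) / 2 ^+ (k * (N + k - (2 * n + d))) *
    (qpoch 4 n * qpoch 4 (N - n - d)) /
    (qpoch 4 (n - k) * qpoch 2 k * qpoch 2 (N + k - (2 * n + d)))
  else 0.

(** The contribution of the vectors [x] outside the radical; for [d = 0] it is the whole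
    recursion. *)
Lemma num_lag_recS N n d k : (0 < N)%N ->
  (2 ^+ k.+1 - 1) * num_lag N n d k.+1 =
  (2 ^+ (2 * n + d) - 2 ^+ d) * num_lag N.-1 n.-1 d k.
Proof.
case: N n => [//|N] [|n] _ /=.
  by rewrite /num_lag /= mulr0 subrr mul0r.
rewrite /num_lag ltnS; case: (leqP k n) => kn /=; last by rewrite !mulr0.
have -> : (2 * n.+1 + d <= N.+1 + k.+1)%N = (2 * n + d <= N + k)%N by lia.
case: ifP => NK; last by rewrite !mulr0.
rewrite subSS.
have -> : (N.+1 + k.+1 - (2 * n.+1 + d) = N + k - (2 * n + d))%N by lia.
rewrite subSS; set e := (N + k - _)%N.
rewrite expr2_bin mulSn !exprD !qpochS mul2n -addnn !exprD expr4E.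
(* Eliminating [2 ^+ N.+1] leaves independent powers, so that the claim becomes an identity of
   rational functions. *)
have -> : 2 ^+ N.+1 =
    2 ^+ e * (2 ^+ n.+1 * 2 ^+ n.+1) * 2 ^+ d / 2 ^+ k.+1 :> rat.
  apply: (canRL (mulfK (expr2_neq0 _))); rewrite -!exprD; congr (_ ^+ _).
  by rewrite /e; lia.
have := expr2B1_neq0 k; have := expr2B1_neq0 n.
have := expr2_neq0 k.+1; have := expr2_neq0 n.+1.
have := qpoch4_neq0 (n - k); have := qpoch2_neq0 k; have := qpoch2_neq0 e.
have := expr2_neq0 e; have := expr2_neq0 (k * e).
move: (2 ^+ k.+1) (2 ^+ n.+1) (qpoch 4 _) (qpoch 4 _) (qpoch 4 _) (qpoch 2 k)
  (qpoch 2 e) (2 ^+ 'C(_, _)) (2 ^+ e) (2 ^+ (k * e)) (2 ^+ d).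
move=> a b p1 p2 p3 p4 p5 c f g h *.
by field; do ?[apply/andP; split].
Qed.

(** [N - n - d] and [N + k - (2 * n + d)] are the same on both sides; only [2 ^+ 'C(N.+1, 2)]
    changes, by the factor [2 ^+ N]. *)
Lemma num_lag_rad N n k : (0 < N)%N ->
  num_lag N.-1 n 0 k = num_lag N n 1 k / 2 ^+ N.
Proof.
case: N => [//|N] _; rewrite /num_lag /=.
have -> : (2 * n + 1 <= N.+1 + k)%N = (2 * n + 0 <= N + k)%N by lia.
case: ifP => NK; last by rewrite mul0r.
have -> : (N.+1 + k - (2 * n + 1) = N + k - (2 * n + 0))%N by lia.
have -> : (N.+1 - n - 1 = N - n - 0)%N by lia.
rewrite [in RHS]expr2_bin [RHS]mulrC -!mulrA mulKf //.
exact: expr2_neq0.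
Qed.

Lemma num_lag0 N n d : num_lag N n d 0 =
  if (2 * n + d <= N)%N then
    2 ^+ 'C(N.+1, 2) * qpoch 4 (N - n - d) / qpoch 2 (N - (2 * n + d))
  else 0.
Proof.
rewrite /num_lag leq0n addn0 mul0n expr0 divr1 subn0 qpoch0 mulr1 /=.
by case: ifP => // _; rewrite mulrCA -mulf_div divff ?mul1r ?qpoch4_neq0.
Qed.

Lemma num_lag_gen0 N n : (0 < N)%N -> (0 < n)%N ->
  num_lag N n 0 0 =
  num_lag N n.-1 1 0 - 2 ^+ (2 * n).-1 * num_lag N.-1 n.-1 0 0.
Proof.
move=> N0; rewrite num_lag_rad //; case: N n N0 => [//|N] [//|n] _ _.
rewrite !num_lag0 [n.+1.-1]/=.
have [nN|nN] := leqP (2 * n + 1) N.+1; last first.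
  by rewrite leqNgt ltnW ?mul0r ?mulr0 ?subr0 //; lia.
have -> : (N.+1 - n - 1 = N - n)%N by lia.
have -> : (N.+1 - (2 * n + 1) = N - 2 * n)%N by lia.
have -> : ((2 * n.+1).-1 = (2 * n).+1)%N by lia.
(* In the boundary case [N = 2 * n] the left side is the default [0], and the right side cancels
   because [2 ^+ (2 * n).+1] is then [2 ^+ N.+1]. *)
have [nN'|nN'] := leqP (2 * n.+1 + 0) N.+1; last first.
  have -> : N = (2 * n)%N by lia.
  have := expr2_neq0 (2 * n).+1; move: (2 ^+ (2 * n).+1) => a a0.
  by rewrite subnn qpoch0; field.
have -> : (N.+1 - n.+1 - 0 = N - n)%N by lia.
have -> : (N.+1 - (2 * n.+1 + 0) = (N - 2 * n).-1)%N by lia.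
have -> : (N - 2 * n = (N - 2 * n).-1.+1)%N by lia.
set e := (N - 2 * n).-1; rewrite qpochS /=.
have -> : 2 ^+ N.+1 = 2 ^+ (2 * n).+1 * 2 ^+ e.+1 :> rat.
  by rewrite -exprD; congr (_ ^+ _); rewrite /e; lia.
have := expr2_neq0 (2 * n).+1; have := expr2_neq0 e.+1.
have := expr2B1_neq0 e; have := qpoch2_neq0 e.
move: (2 ^+ (2 * n).+1) (2 ^+ e.+1) (qpoch _ _) (qpoch _ _) (2 ^+ 'C(_, _)).
by move=> a b p1 p2 c *; field; do ?[apply/andP; split].
Qed.

Lemma num_lag_rad0 N n : (0 < N)%N ->
  num_lag N n 1 0 = num_lag N n 0 0 - num_lag N.-1 n 0 0
    - (2 ^+ (2 * n) - 1) * num_lag N.-1 n.-1 1 0.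
Proof.
move=> N0; rewrite num_lag_rad //.
case: n => [|n].
  (* For [n = 0] the truncated [n.-1] is harmless: its coefficient [2 ^+ 0 - 1] is zero. *)
  rewrite muln0 subrr mul0r subr0 !num_lag0.
  case: N N0 => [//|N] _; rewrite /= !subn0 subn1 [N.+1.-1]/= !qpochS.
  have := expr2_neq0 N.+1; have := expr2B1_neq0 N; have := qpoch2_neq0 N.
  rewrite expr4E; move: (2 ^+ N.+1) (2 ^+ 'C(_, _)) (qpoch _ _) (qpoch _ _).
  by move=> a c p1 p2 *; field; do ?[apply/andP; split].
case: N N0 => [//|N] _; rewrite !num_lag0 [n.+1.-1]/= [N.+1.-1]/=.
have -> : (2 * n.+1 + 0 <= N.+1)%N = (2 * n + 1 <= N)%N by lia.
have [nN|nN] := leqP (2 * n + 1) N; last first.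
  by rewrite leqNgt ltnW ?mul0r ?mulr0 ?subr0 //; lia.
have -> : (N.+1 - n.+1 - 0 = (N - n - 1).+1)%N by lia.
have -> : (N.+1 - (2 * n.+1 + 0) = N - (2 * n + 1))%N by lia.
have -> : (N.+1 - n.+1 - 1 = N - n - 1)%N by lia.
(* In the boundary case [N = (2 * n).+1] the value [num_lag N.+1 n.+1 1 0] is the default [0] on
   both sides, and the other two terms cancel. *)
have [nN'|nN'] := leqP (2 * n.+1 + 1) N.+1; last first.
  have -> : N = (2 * n).+1 by lia.
  have -> : ((2 * n).+1 - n - 1 = n)%N by lia.
  rewrite mul0r !subr0 addn1 subnn qpoch0 qpochS [in RHS]expr2_bin.
  have -> : 2 ^+ (2 * n).+2 = 2 ^+ n.+1 * 2 ^+ n.+1 :> rat.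
    by rewrite -exprD; congr (_ ^+ _); lia.
  have -> : 2 ^+ (2 * n.+1) = 2 ^+ n.+1 * 2 ^+ n.+1 :> rat.
    by rewrite -exprD; congr (_ ^+ _); lia.
  rewrite expr4E; have := expr2_neq0 n.+1.
  by move: (2 ^+ n.+1) (qpoch _ _) (2 ^+ 'C(_, _)) => a p c *; field.
set s := (N - (2 * n.+1))%N.
have -> : (N.+1 - (2 * n.+1 + 1) = s)%N by rewrite /s; lia.
have -> : (N - (2 * n + 1) = s.+1)%N by rewrite /s; lia.
rewrite !qpochS expr2_bin expr4E.
have -> : 2 ^+ N.+1 = 2 ^+ (2 * n.+1) * 2 ^+ s.+1 :> rat.
  by rewrite -exprD; congr (_ ^+ _); rewrite /s; lia.
have -> : 2 ^+ (N - n - 1).+1 = 2 ^+ n.+1 * 2 ^+ s.+1 :> rat.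
  by rewrite -exprD; congr (_ ^+ _); rewrite /s; lia.
have -> : 2 ^+ (2 * n.+1) = 2 ^+ n.+1 * 2 ^+ n.+1 :> rat.
  by rewrite -exprD; congr (_ ^+ _); lia.
have := expr2_neq0 n.+1; have := expr2_neq0 s.+1.
have := expr2B1_neq0 s; have := qpoch2_neq0 s.
move: (2 ^+ n.+1) (2 ^+ s.+1) (qpoch 4 _) (qpoch 2 _) (2 ^+ 'C(_, _)).
by move=> a b p1 p2 c *; field; do ?[apply/andP; split].

Qed.
(** [num_lag N 0 0 0] is the product of the [2 ^+ i + 1] for [1 <= i <= N], the number of all
    Lagrangians in dimension [2 * N]. *)
Lemma num_lag_total N : (0 < N)%N ->
  (2 ^+ N - 1) * num_lag N 0 0 0 = (2 ^+ (2 * N) - 1) * num_lag N.-1 0 0 0.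
Proof.
case: N => [//|N] _; rewrite !num_lag0 /= !subn0 expr2_bin !qpochS.
have := expr2_neq0 N.+1; have := expr2B1_neq0 N; have := qpoch2_neq0 N.
rewrite expr4E mul2n -addnn exprD.
move: (2 ^+ N.+1) (2 ^+ 'C(_, _)) (qpoch _ _) (qpoch _ _).
by move=> a c p1 p2 *; field; do ?[apply/andP; split].
Qed.

(** * Solving the recursions *)

Section Typed.
Variable U : bspace.
Implicit Types (x y : U) (Q A B L S T : {vspace U}) (k N n d : nat).

(* In the symplectic space Q^⊥/Q, of dimension 2N, the subspace A/Q has
   dimension 2n + d and a radical of dimension d. *)
Record typed Q A N n d : Prop := Typed {
  typed_canonical : canonical U \in Q;
  typed_sub : (Q <= A)%VS;
  typed_orth : (A <= Q^⊥)%VS;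
  typed_dimU : \dim {:U} = (2 * (N + \dim Q))%N;
  typed_dim : \dim A = (\dim Q + 2 * n + d)%N;
  typed_rad : \dim (A :&: A^⊥) = (\dim Q + d)%N }.

Lemma natr_expB m n : (n <= m)%N ->
  (2 ^ m - 2 ^ n)%N%:R = 2 ^+ m - 2 ^+ n :> rat.
Proof. by move=> nm; rewrite natrB ?leq_pexp2l // !natrX. Qed.

Lemma card_vectD_natr A B : (B <= A)%VS ->
  #|[set x : finvect_type U | (x \in A) && (x \notin B)]|%:R =
    2 ^+ \dim A - 2 ^+ \dim B :> rat.
Proof. by move=> BA; rewrite card_vectD // natr_expB ?dimvS. Qed.

Lemma sub_rad Q A : (Q <= A)%VS -> (A <= Q^⊥)%VS -> (Q <= A :&: A^⊥)%VS.
Proof. by move=> QA AQ; rewrite subv_cap QA orthov_sym. Qed.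

Lemma leq_dim_isotropic Q : (Q <= Q^⊥)%VS -> (2 * \dim Q <= \dim {:U})%N.
Proof. by move/dimvS; have := dim_orthov Q; lia. Qed.

Lemma typed_line Q A N n d x : typed Q A N n d -> x \in A -> x \notin Q ->
  [/\ (0 < N)%N, canonical U \in (Q + <[x]>)%VS,
      (Q + <[x]> <= A :&: <[x]>^⊥)%VS, (A :&: <[x]>^⊥ <= (Q + <[x]>)^⊥)%VS &
      \dim {:U} = (2 * (N.-1 + \dim (Q + <[x]>)))%N].
Proof.
move=> [cQ QA AQ dU _ _] xA xQ.
have xQ' : x \in (Q^⊥)%VS by exact: (subvP AQ).
have xx : bform x x = 0 by exact: canonical_isotropic xQ'.
have iso := isotropic_add_line (subv_trans QA AQ) xQ' xx.
have dx := dim_add_line xQ.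
have N0 : (0 < N)%N by have := leq_dim_isotropic iso; rewrite dx dU; lia.
split=> //; first exact: (subvP (addvSl _ _)).
- rewrite subv_cap !subv_add QA -!memvE xA mem_orthov1 xx eqxx andbT /=.
  by rewrite andbT orthov_sym; exact: xQ'.
- by rewrite orthov_add capvS.
by rewrite dx dU; lia.
Qed.

(** [A] lies in [<x>^⊥], so only [Q] grows, and it absorbs one dimension of the radical. *)
Lemma typed_line_rad Q A N n d x : typed Q A N n d ->
    x \in (A :&: A^⊥)%VS -> x \notin Q ->
  typed (Q + <[x]>) (A :&: <[x]>^⊥) N.-1 n d.-1.
Proof.
move=> QAt; rewrite memv_cap => /andP[xA xA'] xQ.
have [N0 cQx sx ox dU] := typed_line QAt xA xQ.
case: QAt => cQ QA AQ _ dA dR; have dx := dim_add_line xQ.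
have Ax : (A :&: <[x]>^⊥ = A)%VS by apply/capv_idPl; rewrite orthov_sym.
have d0 : (0 < d)%N.
  have : (Q + <[x]> <= A :&: A^⊥)%VS.
    by rewrite subv_add sub_rad // -memvE memv_cap xA.
  by move/dimvS; rewrite dx dR; lia.
by split=> //; rewrite ?dx ?Ax ?dA ?dR; lia.
Qed.

(* By the modular law the radical of A ∩ <x>^⊥ is that of A enlarged by x. *)
Lemma dim_line_gen Q A N n d x : typed Q A N n d ->
    x \in A -> x \notin (A^⊥)%VS ->
  \dim A = (\dim (A :&: <[x]>^⊥)).+1 /\
  \dim (A :&: <[x]>^⊥ :&: (A :&: <[x]>^⊥)^⊥) = (\dim Q + d).+1.
Proof.
move=> [cQ QA AQ _ dA dR] xA xA'.
have xx : bform x x = 0 by apply: canonical_isotropic cQ _; exact: (subvP AQ).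
split.
  have : (0 < \dim A)%N.
    rewrite lt0n dimv_eq0; apply: contraNneq xA' => A0.
    by move: xA; rewrite A0 memv0 => /eqP->; rewrite mem0v.
  have : (\dim A).-1 = \dim (A :&: <[x]>^⊥) by exact: eq_dim_orthov1.
  by move: (\dim A) => m; lia.
rewrite -dR -(dim_add_line (x := x)) ?memv_cap ?(negbTE xA') ?andbF //.
congr (\dim _).
have xR : (A :&: A^⊥ + <[x]> <= <[x]>^⊥)%VS.
  rewrite subv_add orthov11 xx eqxx andbT (subv_trans (capvSr _ _)) //.
  exact: orthovS.
rewrite orthov_cap orthovK -capvA [(<[x]>^⊥ :&: _)%VS]capvC capvA.
rewrite -(vspace_modr A^⊥) //; exact/capv_idPl.
Qed.

(** [A] loses one dimension while [Q] and the radical gain one, so [A/Q] loses two and [d] is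
    unchanged. *)
Lemma typed_line_gen Q A N n d x : typed Q A N n d ->
    x \in A -> x \notin (A^⊥)%VS ->
  typed (Q + <[x]>) (A :&: <[x]>^⊥) N.-1 n.-1 d.
Proof.
move=> QAt xA xA'; have [d1 d2] := dim_line_gen QAt xA xA'.
have xQ : x \notin Q.
  apply: contra xA' => xQ; case: QAt => _ _; rewrite orthov_sym => /subvP AQ *.
  exact: AQ.
have [N0 cQx sx ox dU] := typed_line QAt xA xQ.
case: QAt => cQ QA AQ _ dA dR; have dx := dim_add_line xQ.
have := dimvS (capvSl (A :&: <[x]>^⊥) (A :&: <[x]>^⊥)^⊥).
by split=> //; rewrite ?dx ?d2; lia.
Qed.

(** The vectors of [A] outside [Q] are split according to whether they lie in the radical ([c1]) or
    not ([c2]). For [d = 0] the truncated [d.-1] is harmless, since its coefficient vanishes. *)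
Lemma card_lag_rec Q A N n d k (c1 c2 : rat) : typed Q A N n d ->
    (forall Q' A', typed Q' A' N.-1 n d.-1 ->
       #|lag Q' A' (\dim Q' + k)|%:R = c1) ->
    (forall Q' A', typed Q' A' N.-1 n.-1 d ->
       #|lag Q' A' (\dim Q' + k)|%:R = c2) ->
  (2 ^+ k.+1 - 1) * #|lag Q A (\dim Q + k.+1)|%:R =
  (2 ^+ d - 1) * c1 + (2 ^+ (2 * n + d) - 2 ^+ d) * c2.
Proof.
move=> QAt H1 H2; have [cQ QA AQ dU dA dR] := QAt.
apply: (mulfI (expr2_neq0 (\dim Q))).
rewrite mulrA mulrBr mulr1 -exprD -[X in X * _](natr_expB (leq_addr _ _)).
rewrite -natrM mulnC.
rewrite lag_count // natr_sum.
rewrite (bigID (fun x : finvect_type U => x \in (A^⊥)%VS)) /=.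
rewrite (eq_bigr (fun _ => c1)) => [|x /andP[/andP[xA xQ] xA']]; last first.
  have xR : (x : U) \in (A :&: A^⊥)%VS by rewrite (@memv_cap _ U x) xA.
  rewrite -(H1 _ _ (typed_line_rad QAt xR xQ)) /card_lag_line.
  by rewrite (dim_add_line xQ) addSnnS.
rewrite sumr_const [X in (_ + X)](eq_bigr (fun _ => c2)); last first.
  move=> x /andP[/andP[xA xQ] xA'].
  rewrite -(H2 _ _ (typed_line_gen QAt xA xA')) /card_lag_line.
  by rewrite (dim_add_line xQ) addSnnS.
rewrite sumr_const -[c1 *+ _]mulr_natl -[c2 *+ _]mulr_natl mulrDr !mulrA.
congr (_ * _ + _ * _).
  rewrite mulrBr mulr1 -exprD -dR -card_vectD_natr ?sub_rad //; congr _%:R.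
  by apply: eq_card => x; rewrite !inE (@memv_cap _ U x) andbAC.
rewrite mulrBr -!exprD addnA -dA -dR -card_vectD_natr ?capvSl //; congr _%:R.
apply: eq_card => x.
rewrite !inE (@memv_cap _ U x) [LHS]/in_mem /= -andbA.
case: (boolP (x \in A)) => //= xA; case: (boolP (x \in A^⊥)%VS) => //= xA'.
  by rewrite andbF.
rewrite andbT; apply: contra xA' => xQ.
by move: AQ; rewrite orthov_sym => /subvP; apply.
Qed.

(** [lag_hyperplane] with [B] the orthogonal in [A] of a vector outside [Q]: all
    [2 ^+ (\dim Q + (2 * n).-1)] vectors of [A] outside [B] avoid the radical. *)
Lemma card_lag_gen0 Q A N n (c1 c2 : rat) : (0 < n)%N -> typed Q A N n 0 ->
    (forall Q' A', typed Q' A' N n.-1 1 -> #|lag Q' A' (\dim Q')|%:R = c1) ->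
    (forall Q' A', typed Q' A' N.-1 n.-1 0 -> #|lag Q' A' (\dim Q')|%:R = c2) ->
  (0 < N)%N /\ #|lag Q A (\dim Q)|%:R = c1 - 2 ^+ (2 * n).-1 * c2.
Proof.
move=> n0 QAt H1 H2; have [cQ QA AQ dU dA dR] := QAt.
have RQ : (A :&: A^⊥ = Q)%VS.
  by apply/eqP; rewrite eq_sym eqEdim sub_rad //= dR addn0.
have mem_rad (x : U) : x \in A -> (x \in (A^⊥)%VS) = (x \in Q).
  by move=> xA; rewrite -RQ memv_cap xA.
have /subvPn[x0 x0A x0Q] : ~~ (A <= Q)%VS.
  by apply/negP => /dimvS; rewrite dA; lia.
have [N0 _ Qx0 x0Q' _] := typed_line QAt x0A x0Q.
have x0A' : x0 \notin (A^⊥)%VS by rewrite mem_rad.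
have [d1 d2] := dim_line_gen QAt x0A x0A'.
(* The radical of the hyperplane B of A is [Q + <[x0]>]. *)
set B := (A :&: <[x0]>^⊥)%VS in d1 d2 Qx0 x0Q'.
have QB : (Q <= B)%VS by apply: subv_trans Qx0; apply: addvSl.
have BA : (B <= A)%VS by apply: capvSl.
have Bt : typed Q B N n.-1 1.
  by split=> //; rewrite ?(subv_trans BA AQ) ?d2 //; lia.
split=> //; apply: (mulfI (expr2_neq0 (\dim Q))).
have := congr1 (fun m => m%:R : rat) (lag_hyperplane QB BA d1).
rewrite natrD !natrM (H1 _ _ Bt) natrX natr_sum mulrC.
rewrite [\sum_(_ | _) _](eq_bigr (fun _ => c2)); last first.
  move=> x /andP[xA xB].
  have xQ : (x : U) \notin Q by apply: contra xB; apply: (subvP QB).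
  rewrite -(H2 (Q + <[x : U]>) (A :&: <[x : U]>^⊥))%VS.
    by rewrite (dim_add_line xQ).
  by apply: typed_line_gen; rewrite // mem_rad.
rewrite sumr_const -[c2 *+ _]mulr_natl mulrBr [_ * #|_|%:R]mulrC => ->.
apply/esym/eqP; rewrite subr_eq mulrA; apply/eqP; congr (_ + _ * _).
rewrite -exprD; transitivity (2 ^+ \dim A - 2 ^+ \dim B : rat).
  rewrite -card_vectD_natr //; congr _%:R; apply: eq_card => x; by rewrite !inE.
rewrite d1 exprS mulr_natl mulr2n addrK; congr (_ ^+ _); lia.
Qed.

(** [lag_hyperplane] with [B] a complement of the radical modulo [Q]: of the [2 ^+ (2 * n)] classes
    outside [B], one lies in the radical and yields [c1], the others yield [c2]. *)
Lemma card_lag_rad0 Q A N n (c0 c1 c2 : rat) : typed Q A N n 1 ->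
    (forall Q' A', typed Q' A' N n 0 -> #|lag Q' A' (\dim Q')|%:R = c0) ->
    (forall Q' A', typed Q' A' N.-1 n 0 -> #|lag Q' A' (\dim Q')|%:R = c1) ->
    (forall Q' A', typed Q' A' N.-1 n.-1 1 -> #|lag Q' A' (\dim Q')|%:R = c2) ->
  (0 < N)%N /\
  #|lag Q A (\dim Q)|%:R = c0 - c1 - (2 ^+ (2 * n) - 1) * c2.
Proof.
move=> QAt H0 H1 H2; have [cQ QA AQ dU dA dR] := QAt.
set R := (A :&: A^⊥)%VS in dR; have QR : (Q <= R)%VS by apply: sub_rad.
have RA : (R <= A)%VS by apply: capvSl.
have /subvPn[r rR rQ] : ~~ (R <= Q)%VS by apply/negP => /dimvS; rewrite dR; lia.
have rA : r \in A by apply: (subvP RA).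
have [N0 _ _ _ _] := typed_line QAt rA rQ; split=> //.
(* B is a hyperplane of A, complementary modulo Q to the radical R. *)
pose B := (A :\: R + Q)%VS.
have QB : (Q <= B)%VS by apply: addvSr.
have BA : (B <= A)%VS by rewrite subv_add diffvSl.
have BR : (B :&: R = Q)%VS.
  by rewrite capvC -vspace_modr // capvC capv_diff add0v.
have AE : (B + R = A)%VS.
  rewrite -addvA (addv_idPr QR) -{2}(addv_diff_cap A R); congr addv.
  by rewrite (capv_idPr RA).
have dB : \dim A = (\dim B).+1.
  by have := dimv_sum_cap B R; rewrite AE BR dR; lia.
have Bt : typed Q B N n 0.
  split=> //; rewrite ?(subv_trans BA AQ) //; first by lia.
  rewrite addn0; congr (\dim _); rewrite -BR /R capvA (capv_idPl BA).
  rewrite -AE orthov_add capvA; apply/esym/capv_idPl.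
  rewrite (subv_trans (capvSl _ _)) // (subv_trans BA) // orthov_sym.
  exact: capvSr.
apply: (mulfI (expr2_neq0 (\dim Q))).
have := congr1 (fun m => m%:R : rat) (lag_hyperplane QB BA dB).
rewrite natrD !natrM (H0 _ _ Bt) natrX natr_sum mulrC.
rewrite (bigID (fun x : finvect_type U => x \in R)) /=.
have notQ x : x \notin B -> x \notin Q by apply: contra; apply: (subvP QB).
rewrite (eq_bigr (fun _ => c1)) => [|x /andP[/andP[xA xB] xR]]; last first.
  rewrite -(H1 _ _ (typed_line_rad QAt xR (notQ _ xB))) /card_lag_line.
  by rewrite (dim_add_line (notQ _ xB)).
rewrite sumr_const [X in _ + (_ + X)](eq_bigr (fun _ => c2)); last first.
  move=> x /andP[/andP[xA xB] xR].
  rewrite -(H2 (Q + <[x : U]>) (A :&: <[x : U]>^⊥))%VS.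
    by rewrite (dim_add_line (notQ _ xB)).
  apply: typed_line_gen => //; apply: contra xR => xR.
  by rewrite (@memv_cap _ U x) xA.
rewrite sumr_const -[c1 *+ _]mulr_natl -[c2 *+ _]mulr_natl.
set m1 := #|_|; set m2 := #|_|.
have m12 : m1%:R + m2%:R = 2 ^+ \dim Q * 2 ^+ (2 * n) :> rat.
  transitivity (2 ^+ \dim A - 2 ^+ \dim B : rat).
    rewrite -card_vectD_natr // -natrD; congr _%:R.
    rewrite -(cardsID [set x : finvect_type U | x \in R]).
    congr (_ + _)%N; apply: eq_card => x; rewrite !inE //.
    by rewrite andbC.
  rewrite dB exprS mulr_natl mulr2n addrK -exprD; congr (_ ^+ _); lia.
(* [B] meets [R] in [Q], so these are the vectors of [R] outside [Q]. *)
have m1E : m1%:R = 2 ^+ \dim Q :> rat.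
  transitivity (2 ^+ \dim R - 2 ^+ \dim Q : rat).
    rewrite -card_vectD_natr //; congr _%:R; apply: eq_card => x; rewrite !inE.
    rewrite [LHS]/in_mem /= andbC; case: (boolP (x \in R)) => //= xR.
    by rewrite (subvP RA) //= -BR (@memv_cap _ U x) xR andbT.
  by rewrite dR addn1 exprS mulr_natl mulr2n addrK.
have m2E : m2%:R = 2 ^+ \dim Q * 2 ^+ (2 * n) - 2 ^+ \dim Q :> rat.
  by rewrite -m12 m1E addrAC subrr add0r.
rewrite m1E m2E => E.
have -> : 2 ^+ \dim Q * (c0 - c1 - (2 ^+ (2 * n) - 1) * c2) = 2 ^+ \dim Q * c0
    - (2 ^+ \dim Q * c1 + (2 ^+ \dim Q * 2 ^+ (2 * n) - 2 ^+ \dim Q) * c2).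
  by move: (2 ^+ \dim Q) (2 ^+ (2 * n)) => a b {E m12 m1E m2E H0 H1 H2}; ring.
by rewrite E addrK mulrC.
Qed.

End Typed.

Section Count.
Variable U : bspace.
Implicit Types (x y : U) (Q A B L S T : {vspace U}) (k N n d : nat).

(** [A] is contained in the orthogonal of its radical; comparing dimensions gives the bound. *)
Lemma typed_rank_leq Q A N n d : typed Q A N n d -> (n + d <= N)%N.
Proof.
move=> [cQ QA AQ dU dA dR].
have : (A <= (A :&: A^⊥)^⊥)%VS by rewrite orthov_sym capvSr.
by move/dimvS; have := dim_orthov (A :&: A^⊥)%VS; lia.
Qed.

(** By dimension [A] is all of [Q^⊥], so this counts every Lagrangian containing [Q]. *)
Lemma card_lag_full N Q A : typed Q A N N 0 ->
  #|lag Q A (\dim Q + N)|%:R = num_lag N 0 0 0.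
Proof.
elim: N Q A => [|N IH] Q A QAt.
  case: QAt => _ QA AQ dU dA _; have := dim_orthov Q.
  rewrite num_lag0 /= !qpoch0 addn0 => dQ.
  have AE : A = Q by apply/eqP; rewrite eq_sym eqEdim QA; lia.
  have QE : (Q^⊥ = Q)%VS.
    by apply/eqP; rewrite eq_sym eqEdim -{1}AE AQ /=; lia.
  rewrite (_ : lag Q A (\dim Q) = [set Q]) ?cards1 ?divr1 //.
  apply/setP => L; rewrite in_set1 lagE AE.
  apply/and3P/eqP => [[/eqP LL QL _]|->].
    by apply/eqP; rewrite eqEsubv QL andbT LL -QE orthovS.
  by rewrite QE subvv capvv !eqxx.
apply: (mulfI (expr2B1_neq0 N)); rewrite num_lag_total //.
(* [c1 = 0] belongs to a type with [n = N.+1] in rank [N], which [typed_rank_leq] excludes. *)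
rewrite (card_lag_rec (c1 := 0) (c2 := num_lag N 0 0 0) QAt) //.
  by rewrite expr0 subrr mul0r add0r addn0.
by move=> Q' A' /typed_rank_leq; rewrite /=; lia.
Qed.

Lemma card_lag_total Q N : canonical U \in Q -> (Q <= Q^⊥)%VS ->
    \dim {:U} = (2 * (N + \dim Q))%N ->
  #|[set L : {vspace U} | (L == L^⊥)%VS && (Q <= L)%VS]|%:R = num_lag N 0 0 0.
Proof.
move=> cQ QQ dU; have := dim_orthov Q => dQ.
rewrite -(@card_lag_full _ Q (Q^⊥)%VS); last first.
  split=> //; first by lia.
  by rewrite orthovK (capv_idPr QQ) addn0.
congr _%:R; apply: eq_card => L; rewrite lagE inE /is_lag.
case: eqP => //= LL; case: (boolP (Q <= L)%VS) => //= QL.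
have LQ : (L <= Q^⊥)%VS by rewrite LL orthovS.
have := dim_orthov L; rewrite -LL (capv_idPl LQ) => dL.
by apply/esym/eqP; lia.
Qed.

Lemma card_lag_cap0 d N n Q A : (d <= 1)%N -> typed Q A N n d ->
  #|lag Q A (\dim Q)|%:R = num_lag N n d 0.
Proof.
(* The recursions may keep [N] while passing from [(n, 0)] to [(n.-1, 1)] and from [(n, 1)] to
   [(n, 0)]; the sum [N + (2 * n + d)] always decreases. *)
have [m] := ubnP (N + (2 * n + d)); elim: m => // m IH in d N n Q A *.
move=> nm d1 QAt; have N_ge := typed_rank_leq QAt.
case: d d1 => [|[|//]] _ in nm QAt N_ge *.
  case: (posnP n) => [n0|n0] in nm QAt N_ge *.
    case: QAt => cQ QA AQ dU dA _; rewrite n0 addn0 in dA *.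
    have AE : A = Q by apply/eqP; rewrite eq_sym eqEdim QA; lia.
    rewrite -(card_lag_total cQ _ dU) ?(subv_trans QA) //; congr _%:R.
    apply: eq_card => L; rewrite lagE inE /is_lag AE.
    by case: eqP => //= LL; apply: andb_idr => QL; rewrite (capv_idPr QL).
  have [||N0 ->] := card_lag_gen0 (c1 := num_lag N n.-1 1 0)
    (c2 := num_lag N.-1 n.-1 0 0) n0 QAt; last by rewrite [RHS]num_lag_gen0.
  - by move=> Q' A' ?; apply: IH => //; lia.
  - by move=> Q' A' ?; apply: IH => //; lia.
have [|||N0 ->] := card_lag_rad0 (c0 := num_lag N n 0 0)
  (c1 := num_lag N.-1 n 0 0) (c2 := num_lag N.-1 n.-1 1 0) QAt; last first.
- by rewrite [RHS]num_lag_rad0.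
- by move=> Q' A' ?; apply: IH => //; lia.
- by move=> Q' A' ?; apply: IH => //; lia.
- by move=> Q' A' ?; apply: IH => //; lia.
Qed.

Lemma card_lag_nondeg Q A N n k : typed Q A N n 0 ->
  #|lag Q A (\dim Q + k)|%:R = num_lag N n 0 k.
Proof.
elim: k => [|k IH] in Q A N n * => QAt.
  by rewrite addn0 (card_lag_cap0 _ QAt).
apply: (mulfI (expr2B1_neq0 k)).
rewrite (card_lag_rec QAt (fun Q' A' => IH Q' A' N.-1 n)
  (fun Q' A' => IH Q' A' _ _)).
rewrite expr0 subrr mul0r add0r.
have := typed_rank_leq QAt; case: (posnP N) => [-> |N0 _]; last first.
  by rewrite num_lag_recS.
by rewrite addn0 leqn0 => /eqP ->; rewrite /num_lag /= subrr mul0r mulr0.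
Qed.

(** The two terms count the Lagrangians that do not, respectively do, contain the radical of [A]: by
    [num_lag_rad] the second is [num_lag N.-1 n 0 k'], the count once the radical has been added to
    [Q]. *)
Definition num_lag_radical N n k : rat :=
  num_lag N n 1 k + (if k is k'.+1 then num_lag N n 1 k' / 2 ^+ N else 0).

Lemma card_lag_radical Q A N n k : typed Q A N n 1 ->
  #|lag Q A (\dim Q + k)|%:R = num_lag_radical N n k.
Proof.
elim: k => [|k IH] in Q A N n * => QAt.
  by rewrite addn0 (card_lag_cap0 _ QAt) // /num_lag_radical addr0.
have N0 : (0 < N)%N by have := typed_rank_leq QAt; lia.
apply: (mulfI (expr2B1_neq0 k)).
rewrite (card_lag_rec QAt (fun Q' A' => @card_lag_nondeg Q' A' N.-1 n k)
  (fun Q' A' => IH Q' A' _ _)).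
rewrite /num_lag_radical num_lag_rad // expr1.
set h := (match k with 0 => 0 | _.+1 => _ end).
(* The weight [1] of the radical and this [2 * (2 ^+ k - 1)] add up to the coefficient
   [2 ^+ k.+1 - 1]. *)
have hE : (2 ^+ (2 * n + 1) - 2) * h =
    2 * (2 ^+ k - 1) * (num_lag N n 1 k / 2 ^+ N).
  rewrite /h; case: k {IH h} => [|k]; first by rewrite expr0 subrr mulr0 !mul0r.
  have := num_lag_recS n 1 k N0; rewrite expr1 mulrA => <-.
  have -> : 2 ^+ N = 2 * 2 ^+ N.-1 :> rat by rewrite -exprS prednK.
  have := expr2_neq0 N.-1; move: (2 ^+ N.-1) (2 ^+ k.+1) (num_lag _ _ _ _).
  by move=> a b c a0; field.
rewrite !mulrDr num_lag_recS // hE [2 ^+ k.+1]exprS expr1.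
move: (2 ^+ k) (num_lag N n 1 k / 2 ^+ N) (_ * num_lag _ _ _ _) => a b c.
by ring.
Qed.

End Count.

(** * Application to S ∩ V *)

Lemma canonicalE (U : bspace) (c : U) :
  (forall x, bform c x = bform x x) -> canonical U = c.
Proof.
move=> cP; apply: is_canonical_uniq; apply/is_canonicalP => // x.
exact: canonicalP.
Qed.

Lemma canonical_osum (U V : bspace) :
  canonical (U ⊞ V) = opair (canonical U) (canonical V).
Proof. by apply: canonicalE => x; rewrite !osumE /= !canonicalP. Qed.

Lemma dim_osum (U V : bspace) :
  \dim {:U ⊞ V} = (\dim {:U} + \dim {:V})%N.
Proof. by rewrite !dimvf. Qed.

Section Summand.
Variables V W : bspace.
Implicit Types (Q L : {vspace V ⊞ W}) (v : V).
Let vc := canonical V.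
Let inl := linfun (@inl_vec V W).

Lemma inlE v : inl v = opair v 0.
Proof. by rewrite lfunE. Qed.

Lemma inl_inj : lker inl == 0%VS.
Proof. by apply/lker0P => u v; rewrite !inlE => -[]. Qed.

Lemma bform_inl v (x : V ⊞ W) : bform (inl v) x = bform v x.1.
Proof. by rewrite inlE osumE /= linear0l addr0. Qed.

(** The intersection of [V] with [Q^⊥] for every [Q] in question ([summandl_orthov]), described
    without [Q]. *)
Definition radV : {vspace V ⊞ W} := (inl @: <[vc]>^⊥)%VS.

Lemma dim_radV : vc != 0 -> \dim radV = (\dim {:V}).-1.
Proof.
move=> vc0; rewrite limg_dim_eq ?(eqP inl_inj) ?capv0 //.
by have := dim_orthov <[vc]>%VS; rewrite dim_vline vc0; lia.
Qed.

Lemma rad_radV : bform vc vc = 0 -> (radV :&: radV^⊥)%VS = <[inl vc]>%VS.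
Proof.
move=> vcvc; apply/eqP; rewrite eqEsubv; apply/andP; split; last first.
  have vcr : vc \in (<[vc]>^⊥)%VS by rewrite mem_orthov1 vcvc.
  rewrite -memvE memv_cap memv_img //=.
  apply/mem_orthovP => _ /memv_imgP[u uv ->].
  rewrite bform_inl inlE /=; move/mem_orthovP: uv => uv.
  by rewrite bformC uv ?memv_line.
apply/subvP => _ /memv_capP[/memv_imgP[v _ ->] /mem_orthovP vr].
rewrite -limg_line memv_img // -(orthovK <[vc]>).
apply/mem_orthovP => u ur; have := vr _ (memv_img inl ur).
by rewrite bform_inl inlE.
Qed.

(** Orthogonality of [(v, 0)] to the canonical vector of the sum amounts to [v] being orthogonal to
    [vc]. *)
Lemma summandl_orthov Q : canonical (V ⊞ W) \in Q -> (Q <= radV^⊥)%VS ->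
  (summandl V W :&: Q^⊥)%VS = radV.
Proof.
move=> cQ QK; apply/eqP.
rewrite eqEsubv subv_cap [(radV <= Q^⊥)%VS]orthov_sym QK.
rewrite limgS ?subvf // !andbT; apply/subvP => _ /memv_capP[/memv_imgP[v _ ->]].
move=> /mem_orthovP /(_ _ cQ); rewrite bform_inl canonical_osum => vvc.
by rewrite memv_img // mem_orthov1 vvc.
Qed.

(** As [Q] is isotropic, [V ∩ Q] lies in [radV]; as [Q] is orthogonal to [radV], it even lies in the
    radical, the line of [(vc, 0)]. *)
Lemma summandl_cap Q : canonical (V ⊞ W) \in Q -> (Q <= radV^⊥)%VS ->
    (Q <= Q^⊥)%VS -> bform vc vc = 0 ->
  (summandl V W :&: Q = <[opair vc 0%R]> :&: Q)%VS.
Proof.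
move=> cQ QK QQ vcvc; apply/eqP; rewrite eqEsubv !subv_cap !capvSr !andbT.
rewrite -inlE -rad_radV // subv_cap (subv_trans (capvSr _ _) QK) andbT.
rewrite -{1}(summandl_orthov cQ QK) subv_cap capvSl.
rewrite (subv_trans (capvSr _ _)) //=.
rewrite rad_radV // (subv_trans (capvSl _ _)) // -memvE memv_img ?memvf //.
Qed.

Section Count.
Variables (Q : {vspace V ⊞ W}) (N n : nat).
Hypotheses (cQ : opair vc (canonical W) \in Q) (QK : (Q <= radV^⊥)%VS).
Hypotheses (QQ : totally_isotropic Q) (vc0 : vc != 0) (vcvc : bform vc vc = 0).
Hypotheses (dV : \dim {:V} = (2 * n).+2).
Hypotheses (dVW : (\dim {:V} + \dim {:W} = 2 * (N + \dim Q))%N).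

Let A := (radV + Q)%VS.
Let cQ' : canonical (V ⊞ W) \in Q. Proof. by rewrite canonical_osum. Qed.

Let vc0' : opair vc (0 : W) != 0.
Proof. by apply: contraNneq vc0 => -[->]. Qed.

Let dim_vc_cap :
  \dim (<[opair vc 0%R]> :&: Q)%VS = (opair vc 0%R \in Q) :> nat.
Proof.
case: (boolP (_ \in Q)) => vQ.
  by rewrite (capv_idPl _) ?dim_vline ?vc0' // -memvE.
apply/eqP; rewrite dimv_eq0 -subv0; apply/subvP => x.
rewrite memv_cap memv_lineF2 memv0 => /andP[/orP[//|/eqP->]].
by rewrite (negbTE vQ).
Qed.

(** The radical of [radV] is the line of [(vc, 0)], which survives modulo [Q] exactly when [(vc, 0)]
    is not in [Q]; this boolean serves as [d]. *)
Let typedQ : typed Q A N n (opair vc 0 \notin Q).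
Proof.
have sK : (radV <= summandl V W)%VS by rewrite limgS ?subvf.
have KQ : (radV :&: Q = <[opair vc 0%R]> :&: Q)%VS.
  rewrite -(summandl_cap cQ') // -(summandl_orthov cQ' QK) -capvA.
  by rewrite (capv_idPr QQ).
have AQ : (A <= Q^⊥)%VS by rewrite subv_add orthov_sym QK.
split=> //; first exact: addvSr.
- by rewrite dim_osum dVW.
- have := dimv_sum_cap radV Q; rewrite KQ dim_vc_cap dim_radV // dV -/A.
  by case: (_ \in Q) => /=; lia.
have -> : (A :&: A^⊥ = <[opair vc 0%R]> + Q)%VS.
  rewrite capvC -vspace_modr; last by rewrite orthov_sym.
  rewrite /A orthov_add -capvA [(Q^⊥ :&: _)%VS]capvC.
  rewrite (capv_idPl (_ : (radV <= Q^⊥)%VS)); last by rewrite orthov_sym.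
  by rewrite capvC rad_radV // inlE.
have := dimv_sum_cap <[opair vc (0%R : W)]> Q.
rewrite dim_vc_cap dim_vline vc0' /=.
by case: (_ \in Q) => /=; lia.
Qed.

(** By the modular law [L ∩ A = (L ∩ V) + Q], and [V ∩ Q] has dimension [1] or [0] according as
    [(vc, 0)] is in [Q] or not: hence the shift. *)
Lemma prob_dim_lag k : prob_dim Q ((opair vc 0 \in Q) + k) =
  #|lag Q A (\dim Q + k)|%:R / num_lag N 0 0 0.
Proof.
have max_eq L : max_totally_isotropic L && (Q <= L)%VS =
    (L == L^⊥)%VS && (Q <= L)%VS.
  case: (boolP (Q <= L)%VS) => QL; rewrite ?andbF //.
  by rewrite max_isotropicE ?(subvP QL).
rewrite /prob_dim /unif_prob -(card_lag_total cQ' QQ); last by rewrite dim_osum.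
congr (_%:R / _%:R); apply: eq_card => L; rewrite !inE max_eq // /is_lag -andbA.
case: eqP => //= LL; case: (boolP (Q <= L)%VS) => //= QL.
have LQ : (L <= Q^⊥)%VS by rewrite LL orthovS.
rewrite /A -vspace_modr // -(summandl_orthov cQ' QK).
rewrite [(summandl _ _ :&: _)%VS]capvC capvA (capv_idPl LQ).
have := dimv_sum_cap (L :&: summandl V W) Q.
rewrite -capvA (summandl_cap cQ') // (capv_idPr (subv_trans (capvSr _ _) QL)).
rewrite dim_vc_cap.
by move: (\dim _) (\dim _) (\dim _) (_ \in Q) => a b c d E; apply/eqP/eqP; lia.
Qed.

Lemma prob_dim_nondeg k : opair vc 0 \in Q ->
  prob_dim Q k.+1 = num_lag N n 0 k / num_lag N 0 0 0.
Proof.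
move=> vQ; have := prob_dim_lag k; have := typedQ; rewrite vQ /= add1n => tQ ->.
by rewrite (card_lag_nondeg _ tQ).
Qed.

Lemma prob_dim_radical k : opair vc 0 \notin Q ->
  prob_dim Q k = num_lag_radical N n k / num_lag N 0 0 0.
Proof.
move=> vQ; have := prob_dim_lag k; have := typedQ; rewrite vQ (negbTE vQ) add0n.
by move=> tQ ->; rewrite (card_lag_radical _ tQ).
Qed.

Lemma rank_geq : (n + (opair vc 0%R \notin Q) <= N)%N.
Proof. exact: typed_rank_leq typedQ. Qed.

End Count.
End Summand.

(** * The closed counts in terms of [C] *)

Lemma num_lag_gt N n d k : (n < k)%N -> num_lag N n d k = 0.
Proof. by rewrite /num_lag ltnNge => /negbTE->. Qed.

(** Dividing by [num_lag N 0 0 0] cancels [2 ^+ 'C(N.+1, 2)] and supplies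
    [qpoch 2 N / qpoch 4 N]. *)
Lemma C_num_lag N n d m k : N = (2 * n + m + d)%N -> (k <= n)%N ->
  C d n m k = num_lag N n d k / num_lag N 0 0 0.
Proof.
move=> NE kn; rewrite num_lag0 /num_lag kn /C.
have -> /= : (2 * n + d <= N + k)%N by lia.
rewrite !subn0.
have -> : (N + k - (2 * n + d) = k + m)%N by lia.
have -> : (N - n - d = n + m)%N by lia.
rewrite -NE.
have := expr2_neq0 'C(N.+1, 2); have := expr2_neq0 (k * (k + m)).
have := qpoch4_neq0 N; have := qpoch2_neq0 N; have := qpoch4_neq0 (n - k).
have := qpoch2_neq0 k; have := qpoch2_neq0 (k + m).
move: (2 ^+ 'C(_, _)) (2 ^+ (k * _)) (qpoch 4 N) (qpoch 2 N) (qpoch 4 (n - k)).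
move: (qpoch 2 k) (qpoch 2 _) (qpoch 4 _) (qpoch 4 _) => a b c e f g h i j *.
by field; do ?[apply/andP; split].
Qed.

(* Exchanging A with its orthogonal: the parameters (n+1, m, k+1) with m = -1
   give the same value as (n, 1, k). *)
Lemma C_num_lag1 N n d k : N = (2 * n + 1 + d)%N -> (k <= n)%N ->
  C d n 1 k = num_lag N n.+1 d k.+1 / num_lag N 0 0 0.
Proof.
move=> NE kn; rewrite (C_num_lag NE) //; congr (_ / _).
rewrite /num_lag ltnS kn.
have -> : (2 * n + d <= N + k)%N by lia.
have -> : (2 * n.+1 + d <= N + k.+1)%N by lia.
rewrite /= subSS.
have -> : (N + k.+1 - (2 * n.+1 + d) = k)%N by lia.
have -> : (N + k - (2 * n + d) = k.+1)%N by lia.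
have -> : (N - n - d = n.+1)%N by lia.
have -> : (N - n.+1 - d = n)%N by lia.
by rewrite [(k.+1 * k)%N]mulnC; congr (_ * _ / _); [exact: mulrC|exact: mulrAC].
Qed.

(** The end values lose one term: [k = 0] has no predecessor, and at [k = n.+1] the first summand
    vanishes by [num_lag_gt]. *)
Lemma num_lag_radical_dist N n m (P : nat -> rat) : N = (2 * n + m + 1)%N ->
  (forall k, P k = num_lag_radical N n k / num_lag N 0 0 0) ->
  [/\ P 0%N = C 1 n m 0,
      forall k, (0 < k < n.+1)%N -> P k = C 1 n m k + C 1 n m (k - 1) / 2 ^+ N
    & P n.+1 = C 1 n m n / 2 ^+ N].
Proof.
move=> NE PE; split=> [|[|k]|]; rewrite ?PE /num_lag_radical //.
- by rewrite addr0 (C_num_lag NE).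
- rewrite ltnS => kn; rewrite subn1 !(C_num_lag NE) //; last exact: ltnW.
  by rewrite mulrDl [_ / _ / _]mulrAC.
by rewrite num_lag_gt // add0r (C_num_lag NE) // mulrAC.
Qed.

(** Here [N = 2 * n.+1] is less than [2 * n.+1 + 1], so [num_lag N n.+1 1 0] vanishes and the
    distribution starts at [1]. *)
Lemma num_lag_radical_dist1 N n (P : nat -> rat) : N = (2 * n + 1 + 1)%N ->
  (forall k, P k = num_lag_radical N n.+1 k / num_lag N 0 0 0) ->
  [/\ P 1%N = C 1 n 1 0,
      forall k, (1 < k < n.+2)%N ->
        P k = C 1 n 1 (k - 1) + C 1 n 1 (k - 2) / 2 ^+ N
    & P n.+2 = C 1 n 1 n / 2 ^+ N].
Proof.
move=> NE PE; split=> [|[|[|k]]|]; rewrite ?PE /num_lag_radical //.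
- rewrite (C_num_lag1 NE) // num_lag0.
  by rewrite leqNgt (_ : (N < _)%N) ?mul0r ?addr0 //; lia.
- rewrite !ltnS => kn; rewrite subn1 subn2.
  rewrite !(C_num_lag1 NE) //; last exact: ltnW.
  by rewrite mulrDl [_ / _ / _]mulrAC.
by rewrite num_lag_gt // add0r (C_num_lag1 NE) // mulrAC.
Qed.

(** * Dimension and canonical vector of the model spaces *)

Section Isometry.
Variables (U U' : bspace) (f : 'Hom(U, U')).
Hypotheses (f_bij : bijective f) (f_iso : isometry (@bform U') (@bform U) f).

Lemma bijective_dim : \dim {:U} = \dim {:U'}.
Proof.
have f0 : lker f == 0%VS by apply/lker0P/bij_inj.
have <- : limg f = {:U'}%VS.
  apply/eqP; rewrite eqEsubv subvf; apply/subvP => y _.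
  by case: f_bij => g _ fK; rewrite -(fK y) memv_img ?memvf.
by rewrite limg_dim_eq ?(eqP f0) ?capv0.
Qed.

Lemma isometry_canonical : f (canonical U) = canonical U'.
Proof.
apply/esym/canonicalE => y; case: f_bij => g _ fK.
by rewrite -(fK y) !f_iso canonicalP.
Qed.

End Isometry.

Lemma dim_opow U t : \dim {:opow U t} = (t * \dim {:U})%N.
Proof.
elim: t => [|t IH]; first by rewrite dimvf /= /dim /= muln0.
by rewrite dim_osum IH.
Qed.

Lemma canonical_spI : canonical spI = (1 : 'F_2).
Proof.
by apply: canonicalE => x; rewrite !spIE mul1r; case: x => -[|[|[]]] // i;
  apply/val_inj.
Qed.

Lemma canonical_opow_spH t : canonical (opow spH t) = 0.
Proof.
elim: t => [|t IH]; first by apply: thinmx0.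
rewrite canonical_osum -/(opow spH t) IH; congr (_, _).
apply: canonicalE => x; rewrite linear0l spHE mxE !big_ord_recl big_ord0 !mxE.
rewrite !big_ord_recl !big_ord0 !mxE /= !(mulr0, mulr1, addr0, add0r).
by rewrite [X in X + _]mulrC -mulr2n -mulr_natr pchar_Fp_0 ?mulr0.
Qed.

Definition spI2H t : bspace := opow spI 2 ⊞ opow spH t.

Lemma canonical_spI2H t : canonical (spI2H t) != 0 /\
  bform (canonical (spI2H t)) (canonical (spI2H t)) = 0.
Proof.
rewrite /spI2H !canonical_osum canonical_opow_spH; split.
  by rewrite canonical_spI; apply/eqP => -[].
rewrite !osumE /= linear0l addr0 canonical_spI; exact/val_inj.
Qed.

Lemma isometric_spI2H (U : bspace) t : isometric U (spI2H t) ->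
  [/\ \dim {:U} = (2 * t).+2, canonical U != 0 &
      bform (canonical U) (canonical U) = 0].
Proof.
case=> f f_bij f_iso; have [c0 cc] := canonical_spI2H t.
rewrite -(isometry_canonical f_bij f_iso) in c0 cc.
split; last by rewrite -f_iso.
  rewrite (bijective_dim f_bij) dim_osum !dim_opow.
  by rewrite !dimvf /dim /=; lia.
by apply: contraNneq c0 => ->; rewrite linear0.
Qed.

Lemma isometric_spH (U : bspace) t : isometric U (opow spH t) ->
  \dim {:U} = (2 * t)%N /\ canonical U = 0.
Proof.
case=> f f_bij f_iso; split.
  by rewrite (bijective_dim f_bij) dim_opow dimvf /dim /= mulnC.
apply: (bij_inj f_bij); rewrite (isometry_canonical f_bij f_iso) linear0.
exact: canonical_opow_spH.
Qed.

(** * Subspaces spanned by explicit pairs *)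

Lemma span_radV (V W : bspace) (X : seq (V ⊞ W)) :
    {in X, forall x, (x.1 == 0) || (x.1 == canonical V)} ->
  (<<X>> <= (radV V W)^⊥)%VS.
Proof.
move=> X1; apply/span_subvP => x /X1; rewrite -memv_lineF2 => x1.
apply/mem_orthovP => _ /memv_imgP[u /mem_orthovP uv ->].
by rewrite bformC bform_inl uv.
Qed.

Lemma addF2_eq0 (U : bspace) (x y : U) : (x + y == 0) = (x == y).
Proof. by rewrite addr_eq0 -[- y]add0r -(addvvF2 y) addrK. Qed.

Lemma mem_span_consF2 (U : bspace) (x a : U) (X : seq U) :
  (x \in <<a :: X>>%VS) = (x \in <<X>>%VS) || (x + a \in <<X>>%VS).
Proof.
rewrite span_cons; apply/memv_addP/orP => [[y]|].
  rewrite memv_lineF2 => /orP[/eqP-> [z zX ->]|/eqP-> [z zX ->]].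
    by left; rewrite add0r.
  by right; rewrite addrAC addvvF2 add0r.
case=> [xX|xaX]; first by exists 0; [exact: mem0v|exists x; rewrite ?add0r].
exists a; first exact: memv_line.
by exists (x + a); rewrite // addrCA addvvF2 addr0.
Qed.

Lemma opairD (V W : bspace) (v v' : V) (w w' : W) :
  opair v w + opair v' w' = opair (v + v') (w + w').
Proof. by []. Qed.

Lemma opair_eq0 (V W : bspace) (v : V) (w : W) :
  (opair v w == 0) = (v == 0) && (w == 0).
Proof. by []. Qed.

(** Reduces freeness of, and membership in the span of, a list of explicit pairs to equations
    between components. *)
Definition span_opairE := (mem_span_consF2, span_nil, memv0, opairD, opair_eq0,
  addr0, add0r, addvvF2, eqxx, free_cons, nil_free).

Lemma dim_span_free (U : bspace) (X : seq U) : free X -> \dim <<X>> = size X.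
Proof. by move/eqP. Qed.

Section Span.
Variables (V W : bspace) (Q : {vspace V ⊞ W}) (X : seq (V ⊞ W)) (N n : nat).
Let vc := canonical V.
Hypotheses (vc0 : vc != 0) (vcvc : bform vc vc = 0).
Hypotheses (dV : \dim {:V} = (2 * n).+2) (QQ : totally_isotropic Q).
Hypotheses (QE : Q = <<X>>%VS) (X_free : free X).
Hypotheses (X1 : all (fun x => (x.1 == 0) || (x.1 == vc)) X).
Hypotheses (cX : opair vc (canonical W) \in <<X>>%VS).
Hypotheses (dVW : (\dim {:V} + \dim {:W} = 2 * (N + size X))%N).

Let cQ : opair vc (canonical W) \in Q. Proof. by rewrite QE. Qed.
Let QK : (Q <= (radV V W)^⊥)%VS.
Proof. by rewrite QE; apply/span_radV/allP. Qed.
Let dVW' : (\dim {:V} + \dim {:W} = 2 * (N + \dim Q))%N.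
Proof. by rewrite QE dim_span_free. Qed.

Lemma prob_dim_span_nondeg : opair vc 0 \in <<X>>%VS ->
  forall k, prob_dim Q k.+1 = num_lag N n 0 k / num_lag N 0 0 0.
Proof.
by rewrite -QE => vQ k; apply: prob_dim_nondeg cQ QK QQ vc0 vcvc dV dVW' _ vQ.
Qed.

Lemma prob_dim_span_radical : opair vc 0 \notin <<X>>%VS -> (n < N)%N /\
  forall k, prob_dim Q k = num_lag_radical N n k / num_lag N 0 0 0.
Proof.
rewrite -QE => vQ; split=> [|k].
  by have := rank_geq cQ QK QQ vc0 vcvc dV dVW'; rewrite vQ addn1.
exact: prob_dim_radical cQ QK QQ vc0 vcvc dV dVW' _ vQ.
Qed.

End Span.

(** In types A(i), A(ii), B(iii), B(iv) the vector [(vc, 0)] is in [SQ], hence [d = 0]; in B(i) and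
    B(ii) it is not, hence [d = 1]. Always [N] is half the dimension of [V ⊞ W] minus the dimension
    of [SQ]. *)
Theorem theorem4p2 (r1 r2 : nat) (V W : bspace) (SQ : {vspace V ⊞ W})
    (r1_ge2 : (2 <= r1)%N) (r1_even : ~~ odd r1)
    (V_iso : isometric V (opow spI 2 ⊞ opow spH (r1./2 - 1)))
    (SQ_isotropic : totally_isotropic SQ) :
  let vc : V := canonical V in
  let wc : W := canonical W in
  let P : nat -> rat := prob_dim SQ in
  [/\
    isometric W (opow spH (r1./2 + r2)) ->
    [/\ (* A(i) *)
      SQ = <<[:: opair vc 0]>>%VS ->
      forall k : nat, (1 <= k <= r1./2)%N ->
        P k = C 0 (r1./2 - 1) (r2 + 1) (k - 1)
    & (* A(ii) *)
      forall w : W, w != 0 -> w != wc ->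
      SQ = <<[:: opair vc 0; opair 0 w]>>%VS ->
      forall k : nat, (1 <= k <= r1./2)%N ->
        P k = C 0 (r1./2 - 1) r2 (k - 1)]
  & isometric W (opow spI 2 ⊞ opow spH (r1./2 + r2 - 1)) ->
    [/\ (* B(i) *)
      SQ = <<[:: opair vc wc]>>%VS ->
      [/\ P 0%N = C 1 (r1./2 - 1) r2 0,
          forall k : nat, (0 < k < r1./2)%N ->
            P k = C 1 (r1./2 - 1) r2 k
                  + C 1 (r1./2 - 1) r2 (k - 1) / 2 ^+ (r1 + r2 - 1)
        & P r1./2 = C 1 (r1./2 - 1) r2 (r1./2 - 1) / 2 ^+ (r1 + r2 - 1)],
      (* B(ii) *)
      forall w : W, w != 0 -> w != wc ->
      SQ = <<[:: opair vc wc; opair 0 w]>>%VS ->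
      (r2 = 0%N ->
        [/\ P 1%N = C 1 (r1./2 - 2) 1 0,
            forall k : nat, (1 < k < r1./2)%N ->
              P k = C 1 (r1./2 - 2) 1 (k - 1)
                    + C 1 (r1./2 - 2) 1 (k - 2) / 2 ^+ (r1 + r2 - 2)
          & P r1./2 = C 1 (r1./2 - 2) 1 (r1./2 - 2) / 2 ^+ (r1 + r2 - 2)]) /\
      ((0 < r2)%N ->
        [/\ P 0%N = C 1 (r1./2 - 1) (r2 - 1) 0,
            forall k : nat, (0 < k < r1./2)%N ->
              P k = C 1 (r1./2 - 1) (r2 - 1) k
                    + C 1 (r1./2 - 1) (r2 - 1) (k - 1) / 2 ^+ (r1 + r2 - 2)
          & P r1./2 = C 1 (r1./2 - 1) (r2 - 1) (r1./2 - 1)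
                      / 2 ^+ (r1 + r2 - 2)]),
      (* B(iii) *)
      SQ = <<[:: opair vc wc; opair 0 wc]>>%VS ->
      forall k : nat, (1 <= k <= r1./2)%N ->
        P k = C 0 (r1./2 - 1) r2 (k - 1)
    & (* B(iv) *)
      forall w : W, w != 0 -> w != wc ->
      SQ = <<[:: opair vc wc; opair 0 wc; opair 0 w]>>%VS ->
      (r2 = 0%N ->
        forall k : nat, (2 <= k <= r1./2)%N ->
          P k = C 0 (r1./2 - 2) 1 (k - 2)) /\
      ((0 < r2)%N ->
        forall k : nat, (1 <= k <= r1./2)%N ->
          P k = C 0 (r1./2 - 1) (r2 - 1) (k - 1))]].
Proof.
have [n r1E] : exists n, r1 = (2 * n.+1)%N.
  exists (r1./2).-1; rewrite prednK; last by lia.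
  by rewrite mul2n even_halfK.
rewrite {r1_ge2 r1_even}r1E in V_iso *; move=> vc wc P.
have h_r1 : (2 * n.+1)./2 = n.+1 by rewrite mul2n doubleK.
rewrite h_r1 subn1 [n.+1.-1]/= in V_iso *.
have [dV vc0 vcvc] := isometric_spI2H V_iso; rewrite -/vc in vc0 vcvc.
have vc0' := negbTE vc0.
split=> [/isometric_spH [dW wc0]|/isometric_spI2H [dW wc0 _]].
  rewrite -/wc in wc0; split=> [SQE [//|k] kn|w w0 w_wc SQE [//|k] kn].
    rewrite subn1 (@C_num_lag (2 * n + (r2 + 1))) ?addn0 //.
    apply: (prob_dim_span_nondeg vc0 vcvc dV SQ_isotropic SQE).
    - by rewrite !span_opairE vc0'.
    - by rewrite /= eqxx orbT.
    - by rewrite -/wc wc0 memv_span ?mem_head.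
    - by rewrite dV dW /=; lia.
    - by rewrite memv_span ?mem_head.
  rewrite subn1 (@C_num_lag (2 * n + r2)) ?addn0 //.
  apply: (prob_dim_span_nondeg vc0 vcvc dV SQ_isotropic SQE).
  - by rewrite !span_opairE vc0' (negbTE w0).
  - by rewrite /= !eqxx orbT.
  - by rewrite -/wc wc0 memv_span ?mem_head.
  - by rewrite dV dW /=; lia.
  - by rewrite memv_span ?mem_head.
have wc0' : (wc == 0) = false by apply/negbTE.
split=> [SQE|w w0 w_wc SQE|SQE [//|k] kn|w w0 w_wc SQE].
- have [||||//|nN PE] := prob_dim_span_radical (N := 2 * n + r2 + 1)
    vc0 vcvc dV SQ_isotropic SQE.
  + by rewrite !span_opairE vc0'.
  + by rewrite /= eqxx orbT.
  + by rewrite memv_span ?mem_head.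
  + by rewrite dV dW /=; lia.
  + by rewrite !span_opairE vc0' wc0'.
  have -> : (2 * n.+1 + r2 - 1 = 2 * n + r2 + 1)%N by lia.
  exact: num_lag_radical_dist PE.
- have [|||||nN PE] := prob_dim_span_radical (N := 2 * n + r2)
    vc0 vcvc dV SQ_isotropic SQE.
  + by rewrite !span_opairE vc0' (negbTE w0).
  + by rewrite /= !eqxx orbT.
  + by rewrite memv_span ?mem_head.
  + by rewrite dV dW /=; lia.
  + rewrite !span_opairE vc0' wc0' (negbTE w0).
    by rewrite addF2_eq0 eq_sym (negbTE w_wc).
  have -> : (2 * n.+1 + r2 - 2 = 2 * n + r2)%N by lia.
  split=> [r20|r2_gt0].
    rewrite r20 addn0 in nN PE *.
    (* Now [nN] reads [n < 2 * n], so [n] is positive: for [r1 = 2] and [r2 = 0] no admissible [w]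
       exists. *)
    have [n' nE] : exists n', n = n'.+1 by exists n.-1; lia.
    by rewrite nE !subSS subn0 in PE *; apply: num_lag_radical_dist1 PE; lia.
  by apply: num_lag_radical_dist PE; lia.
- rewrite subn1 (@C_num_lag (2 * n + r2)) ?addn0 //.
  apply: (prob_dim_span_nondeg vc0 vcvc dV SQ_isotropic SQE).
  + by rewrite !span_opairE vc0' wc0'.
  + by rewrite /= !eqxx orbT.
  + by rewrite memv_span ?mem_head.
  + by rewrite dV dW /=; lia.
  + by rewrite !span_opairE !orbT.
(* The rank is fixed without a subtraction, as [2 * n + r2 - 1] is written differently for [r2 = 0]
   and for [0 < r2]. *)
have PE N : (N + 1 = 2 * n + r2)%N ->
    forall k, P k.+1 = num_lag N n 0 k / num_lag N 0 0 0.
  move=> NE; apply: (prob_dim_span_nondeg vc0 vcvc dV SQ_isotropic SQE).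
  + rewrite !span_opairE vc0' wc0' (negbTE w0).
    by rewrite addF2_eq0 eq_sym (negbTE w_wc).
  + by rewrite /= !eqxx orbT.
  + by rewrite memv_span ?mem_head.
  + by rewrite dV dW /=; lia.
  + by rewrite !span_opairE !orbT.
split=> [r20 [|[|k]]|r2_gt0 [//|k]] // kn.
  have [n' nE] : exists n', n = n'.+1 by exists n.-1; lia.
  rewrite nE in kn PE *.
  rewrite !subSS !subn0 (@C_num_lag1 (2 * n' + 1)) ?addn0 //.
  by rewrite (PE (2 * n' + 1)%N) //; lia.
rewrite subSS subn0 (@C_num_lag (2 * n + (r2 - 1))) ?addn0 //.
by rewrite (PE (2 * n + (r2 - 1))%N) //; lia.
Qed.
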